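(* Let $G$ be a finite simple graph that can be embedded in a surface of nonnegative characteristic. Then $G$ is $(2,1)$-decomposable if at least one of the following holds: (1) $G$ has neither $3$-cycles nor $4$-cycles; (2) $G$ has neither $3$-cycles nor $6$-cycles; (3) $G$ has neither $4$-cycles nor $6$-cycles.
   Context: All graphs are finite and simple. A surface of nonnegative characteristic is one of the Euclidean plane (equivalently the sphere), the projective plane, the torus, or the Klein bottle. A graph is $d$-degenerate if every (nonempty) subgraph has a vertex of degree at most $d$; equivalently, it has an acyclic orientation of maximum out-degree at most $d$. A graph $G$ is $(d,h)$-decomposable if there is a subgraph $H$ of $G$ with maximum degree at most $h$ such that $G-E(H)$ is $d$-degenerate. A $k$-cycle is a cycle (as a subgraph, not necessarily induced) with $k$ vertices. *)

(* Defs.v *)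
From HB Require Import structures.
From mathcomp Require Import all_boot all_order all_fingroup all_algebra.

Set Implicit Arguments.
Unset Strict Implicit.
Unset Printing Implicit Defensive.

Import GRing.Theory Num.Theory.

Section Graphs.

Variable T : finType.
Implicit Types (e f : rel T) (d h k : nat) (S : {set T}) (v : T).

Definition simple_graph e : Prop := symmetric e /\ irreflexive e.

Definition nbr e v : {set T} := [set w | e v w].

Definition degree e v : nat := #|nbr e v|.

(* A k-cycle as a (not necessarily induced) subgraph; meaningful for k >= 3. *)
Definition has_cycle k e : Prop :=
  exists c : seq T, size c = k /\ ucycle e c.

(* (S, f) is a subgraph of the graph with edge relation e. *)
Definition subgraph S f e : Prop :=
  [/\ symmetric f, subrel f e & forall x y, f x y -> (x \in S) && (y \in S)].

Definition degenerate d e : Prop :=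
  forall S f, subgraph S f e -> S != set0 ->
    exists2 v, v \in S & degree f v <= d.

(* Removing E(H) depends only on the edges of H, so that H may be taken to    *)
(* be spanning.                                                               *)
Definition decomposable d h e : Prop :=
  exists2 H : rel T,
    subgraph setT H e /\ (forall v, degree H v <= h) &
    degenerate d (fun x y => e x y && ~~ H x y).

End Graphs.

(* A general (orientable or not) embedding scheme of a graph in a closed      *)
(* surface: a rotation at each vertex v, i.e. a cyclic permutation of the     *)
(* neighbours of v (the values of rotation v elsewhere are irrelevant), and a *)
(* signature telling for each edge whether the local orientations chosen at   *)
(* its two ends disagree when transported along the edge. The surface is      *)
(* obtained by gluing a disc along each facial walk.                          *)
Record embedding_scheme (T : finType) (e : rel T) := EmbeddingScheme {
  rotation : T -> {perm T};
  twisted : rel T;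
  rotation_cyclic : forall v w, e v w -> porbit (rotation v) w = nbr e v;
  twisted_sym : symmetric twisted
}.

Section EulerCharacteristic.

Variables (T : finType) (e : rel T) (M : embedding_scheme e).

(* The flag (v, w, s) is the side s of the half-edge at v towards w; s = true *)
(* is the side facing the half-edge towards rotation M v w.                   *)
Definition flag : finType := (T * T * bool)%type.

Definition is_flag : pred flag := fun x => e x.1.1 x.1.2.

(* Following the same side of the edge to its other end: seen from there, it  *)
(* is the opposite side, unless the edge is twisted.                          *)
Definition along_edge (x : flag) : flag :=
  let: (v, w, s) := x in (w, v, if twisted M v w then s else ~~ s).

(* The other side of the corner of a face that x lies on.                     *)
Definition across_corner (x : flag) : flag :=
  let: (v, w, s) := x in
  if s then (v, rotation M v w, false) else (v, (rotation M v)^-1%g w, true).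

Definition same_face : rel flag :=
  fun x y => (y == along_edge x) || (y == across_corner x).

(* An isolated vertex has no flags, but it lies on a sphere with one face.    *)
Definition nb_faces : nat :=
  n_comp same_face is_flag + #|[set v | nbr e v == set0]|.

Definition edges : {set {set T}} :=
  [set A | [exists x, exists y, e x y && (A == [set x; y])]].

Definition euler_char : int := (#|T|%:Z - #|edges|%:Z + nb_faces%:Z)%R.

End EulerCharacteristic.

(* An embedding scheme of a connected graph H is a cellular embedding of H in *)
(* a closed connected surface of Euler characteristic euler_char M, and this  *)
(* is nonnegative exactly for the sphere, the projective plane, the torus and *)
(* the Klein bottle. An embedding of a graph in a surface need not be         *)
(* cellular, nor the graph connected, but the graph is then a subgraph of a   *)
(* connected simple graph cellularly embedded in the same surface.            *)
Definition embeds_nonneg_char (T : finType) (e : rel T) : Prop :=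
  exists (U : finType) (eH : rel U) (M : embedding_scheme eH) (i : T -> U),
    [/\ simple_graph eH, n_comp eH predT = 1,
        injective i, {homo i : x y / e x y >-> eH x y}
      & (0 <= euler_char M)%R].

(* Main.v *)
Require Import Defs.
From mathcomp Require Import all_boot all_order all_fingroup all_algebra.
From mathcomp Require Import zify ring lra.

Set Implicit Arguments.
Unset Strict Implicit.
Unset Printing Implicit Defensive.

(* A minimal vertex set S whose induced subgraph G is not decomposable gives  *)
(* a graph G of minimum degree 3 in which the vertices of degree 3 are        *)
(* independent. Deleting edges of the connected graph H embedded with         *)
(* nonnegative Euler characteristic never increases 2c - (V - E + F), where c *)
(* counts components, so V - E + F >= 0 for G, whether connected or not: the  *)
(* curvatures 1 - 2/d - 2/l, summed over the flags of G at a vertex of degree *)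
(* d on a face of length l, have a sum that is at most 0.                     *)
(* In cases (1) and (3) a redistribution makes all terms positive. In (3) the *)
(* two faces at an edge have lengths 3 and at least 7, or both at least 5.    *)
(* In (2) the faces of length at least 5 give 1/2 to each of their cubic      *)
(* corners, and two 4-faces are never adjacent. All final charges being 0,    *)
(* the degrees are 3 and 4, the faces have length 4 or 5, and every 5-face    *)
(* has exactly two cubic corners, so that every vertex of degree 4 has two    *)
(* cubic neighbours. Such a graph is decomposable as a whole.                 *)

(* Polynomial roots and orbits of group actions shadow these names. *)
Local Notation root := fingraph.root.
Local Notation rootP := fingraph.rootP.
Local Notation orbit := fingraph.orbit.

(** * Reducible configurations *)

(** The proof combines reducible configurations with discharging. [dec_all] is a strong induction on
    the vertex set: a vertex of degree at most 2 can be removed ([dec_low_degree]), and so can two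
    adjacent vertices of degree at most 3 once their edge is put in the matching ([dec_adjacent3]).
    [irreducible_dec] treats what is left, where degrees are at least 3 and cubic vertices are
    independent. On the topological side, edges are deleted one at a time from the ambient connected
    graph while components and faces are followed ([euler_subgraph]). This yields V - E + F >= 0 for
    the remaining graph, isolated vertices being discounted ([darts_sub_scheme]); spread over the
    flags, it becomes [curvature_le0]. On the combinatorial side, short faces are short cycles, so
    the forbidden cycles restrict neighbouring faces ([face4_not_adjacent], [face3_neighbour]).
    Cases (1) and (3) then contradict [curvature_le0] ([girth5_contradiction],
    [no_cycles46_contradiction]). In case (2) the charges are only nonnegative; all are then 0,
    which puts two cubic vertices next to each vertex of degree 4 ([no_cycles36_cubic_nbrs]), and
    [dec_cubic_neighbours] decomposes such a graph by a suitable order of removal. *)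

Section Decomposition.

Variables (T : finType) (e : rel T).
Hypothesis e_simple : simple_graph e.
Implicit Types (K Y S X : {set T}) (u v w a b y : T).

Definition nbr_in K v : {set T} := [set w in K | e v w].

(* [Y] is a set of vertices kept free for later matching edges. *)
Definition decomposable_in K Y : Prop :=
  exists2 H : rel T,
    [/\ symmetric H,
        forall x y, H x y -> [&& e x y, x \in K :\: Y & y \in K :\: Y]
      & forall x, degree H x <= 1] &
    forall X, X \subset K -> X != set0 ->
      exists2 v, v \in X & #|[set w in X | e v w && ~~ H v w]| <= 2.

Lemma dec0 Y : decomposable_in set0 Y.
Proof.
exists [rel _ _ | false] => [|X].
  by split=> // x; rewrite /degree /nbr; under eq_finset do []; rewrite cards0.
by rewrite subset0 => ->.
Qed.

Lemma dec_decomposable : decomposable_in setT set0 -> decomposable 2 1 e.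
Proof.
case=> H [symH subH degH] decH; exists H.
  split=> //; split=> // x y /subH; first by case/andP.
  by rewrite !inE.
move=> S f [symf subf fS] S_neq0.
have [v vS dv] := decH S (subsetT _) S_neq0; exists v => //.
apply: leq_trans dv; apply/subset_leq_card/subsetP => w; rewrite !inE => fvw.
by rewrite subf // andbT; case/andP: (fS _ _ fvw).
Qed.

(** In any [X] containing [v], the vertex [v] itself has small degree without help from the
    matching; it thus stays unmatched and may join the protected set. *)
Lemma dec_low_degree K Y v :
  v \in K -> #|nbr_in K v| <= 2 -> decomposable_in (K :\ v) Y -> decomposable_in K (v |: Y).
Proof.
move=> vK dv [H [symH subH degH] decH]; exists H.
  split=> // x y /subH; rewrite !inE !negb_or -!andbA.
  by case/and5P=> -> -> -> -> /and3P[-> -> ->].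
move=> X XK X_neq0; case vX : (v \in X).
  exists v => //; apply: leq_trans dv; apply/subset_leq_card/subsetP => w.
  by rewrite !inE => /and3P[/(subsetP XK) -> ->].
by apply: decH; rewrite // subsetD1 XK vX.
Qed.

(** Matching [a] to [b] leaves [a] at most two other edges in [K], so [a] can be removed first;
    protecting [b] in the rest keeps the enlarged [H] a matching. *)
Lemma dec_match K Y a b :
    a \in K -> b \in K -> e a b -> #|nbr_in K a| <= 3 ->
    a \notin Y -> b \notin Y ->
  decomposable_in (K :\ a) (b |: Y) -> decomposable_in K Y.
Proof.
have [symE irrE] := e_simple.
move=> aK bK eab da aY bY [H [symH subH degH] decH].
have neq_ab : a != b by apply: contraTneq eab => ->; rewrite irrE.
have Ha x : H a x = false by apply/negP => /subH; rewrite !inE eqxx andbF andbC.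
have Hb x : H b x = false by apply/negP => /subH; rewrite !inE eqxx andbF.
have Ha' x : H x a = false by rewrite symH.
have Hb' x : H x b = false by rewrite symH.
pose H' : rel T := [rel x y | [|| H x y, (x == a) && (y == b) | (x == b) && (y == a)]].
exists H'.
  split=> [x y|x y|x]; rewrite /H' /=.
  - by rewrite symH; case: (H y x) => //=; rewrite orbC; congr orb; rewrite andbC.
  - case/or3P=> [/subH|/andP[/eqP -> /eqP ->]|/andP[/eqP -> /eqP ->]].
    + rewrite !inE !negb_or -!andbA.
      by case/and5P=> -> _ -> _ /and5P[-> _ -> _ ->].
    + by rewrite eab !inE aK bK aY bY.
    + by rewrite symE eab !inE aK bK aY bY.
  - have [->|xa] := eqVneq x a.
      rewrite /degree /nbr (_ : [set w | _] = [set b]) ?cards1 //.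
      by apply/setP => w; rewrite !inE /= Ha eqxx (negbTE neq_ab) orbF.
    have [->|xb] := eqVneq x b.
      rewrite /degree /nbr (_ : [set w | _] = [set a]) ?cards1 //.
      by apply/setP => w; rewrite !inE /= Hb eqxx eq_sym (negbTE neq_ab).
    apply: leq_trans (degH x); apply/subset_leq_card/subsetP => w.
    by rewrite !inE /= (negbTE xa) (negbTE xb) /= orbF.
move=> X XK X_neq0; case aX : (a \in X).
  exists a => //; rewrite -ltnS; apply: leq_trans da.
  apply: proper_card; apply/properP; split.
    by apply/subsetP => w; rewrite !inE => /and3P[/(subsetP XK) -> ->].
  by exists b; rewrite !inE ?bK ?eab // /H' /= !eqxx orbT !andbF.
have XK' : X \subset K :\ a by rewrite subsetD1 XK aX.
have [v vX dv] := decH X XK' X_neq0; exists v => //.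
apply: leq_trans dv; apply/subset_leq_card/subsetP => w.
rewrite !inE /= => /and3P[-> ->]; rewrite !negb_or => /andP[-> _] //.
Qed.

(** Matching [v] to [u] disposes of [v]; having lost a neighbour, [u] is then removed without any
    further matching edge. *)
Lemma dec_adjacent3 S u v :
    u \in S -> v \in S -> e u v -> #|nbr_in S u| <= 3 -> #|nbr_in S v| <= 3 ->
  decomposable_in (S :\ v :\ u) set0 -> decomposable_in S set0.
Proof.
have [symE irrE] := e_simple.
move=> uS vS euv du dv d0.
have neq_uv : u != v by apply: contraTneq euv => ->; rewrite irrE.
apply: (@dec_match _ _ v u); rewrite ?inE // 1?symE //.
apply: dec_low_degree => //; first by rewrite !inE neq_uv.
rewrite -ltnS; apply: leq_trans du; apply: proper_card; apply/properP; split.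
  by apply/subsetP => w; rewrite !inE -andbA => /and3P[_ -> ->].
by exists v; rewrite !inE ?eqxx // vS.
Qed.

Lemma card_nbr_in_sub K S v : K \subset S -> #|nbr_in K v| <= #|nbr_in S v|.
Proof.
move=> KS; apply/subset_leq_card/subsetP => w.
by rewrite !inE => /andP[/(subsetP KS) -> ->].
Qed.

Lemma dec_sub K Y Y' : Y' :&: K \subset Y -> decomposable_in K Y -> decomposable_in K Y'.
Proof.
move=> YY' [H [symH subH degH] decH]; exists H => //; split=> // a b /subH.
rewrite !inE => /and3P[-> /andP[aY aK] /andP[bY bK]]; rewrite aK bK !andbT /=.
by apply/andP; split; [apply: contra aY | apply: contra bY] => Y'x;
  apply: (subsetP YY'); rewrite inE Y'x.
Qed.

(* The vertices are removed so that at most one matched vertex [y] remains,   *)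
(* next to a removed vertex: a cubic neighbour [a] of [y] can then be removed,*)
(* matched to some new vertex, and [y] has lost two neighbours.               *)
Lemma dec_cubic_neighbours S :
    (forall v, v \in S -> #|nbr_in S v| <= 4) ->
    (forall v, v \in S -> 3 < #|nbr_in S v| ->
       1 < #|[set w in nbr_in S v | #|nbr_in S w| <= 3]|) ->
  decomposable_in S set0.
Proof.
have [symE irrE] := e_simple.
move=> deg4 nbr3.
suff claim n K Y : #|K| <= n -> K \subset S -> #|Y| <= 1 ->
    (forall y, y \in Y -> y \in K -> exists2 z, z \in S :\: K & e y z) ->
  decomposable_in K Y.
  by apply: (claim #|S|); rewrite ?cards0 // => y; rewrite inE.
elim: n K Y => [|n IHn] K Y.
  by rewrite leqn0 cards_eq0 => /eqP -> *; exact: dec0.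
move=> leKn KS Y1 Yout.
have dec_proper (K' Z : {set T}) : K' \proper K -> #|Z| <= 1 ->
    (forall y, y \in Z -> y \in K' -> exists2 z, z \in S :\: K' & e y z) ->
    decomposable_in K' Z.
  move=> K'K Z1 Zout; apply: IHn => //.
    by rewrite -ltnS (leq_trans (proper_card K'K)).
  exact: subset_trans (proper_sub K'K) KS.
have [/existsP[v /andP[vK dv]]|] := boolP [exists v, (v \in K) && (#|nbr_in K v| <= 2)].
  apply: (@dec_sub _ (v |: Y)); first by rewrite setUC subsetU // subsetIl.
  apply: dec_low_degree => //; apply: dec_proper => // [|y yY].
    by rewrite properD1.
  rewrite !inE => /andP[yv yK]; have [z] := Yout y yY yK.
  rewrite !inE => /andP[zK zS] eyz.
  by exists z; rewrite // !inE (negbTE zK) zS andbF.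
rewrite negb_exists => /forallP high.
have {}high v : v \in K -> 2 < #|nbr_in K v|.
  by move=> vK; have := high v; rewrite vK -ltnNge.
(* At least two neighbours of [v] in [S] are cubic, and at most one of its at most four neighbours
   has left [K]. *)
have cubic v : v \in K -> 3 < #|nbr_in S v| ->
    exists a, [/\ a \in K, e v a & #|nbr_in S a| <= 3].
  move=> vK dv; have vS := subsetP KS v vK; have := nbr3 v vS dv.
  set C := [set w in _ | _] => C2.
  have [C0|[a]] := set_0Vmem (C :&: K); last first.
    by rewrite !inE => /andP[/andP[/andP[aS eva] da] aK]; exists a.
  have CD : C \subset nbr_in S v :\: nbr_in K v.
    apply/subsetP => w wC; move/setP: (C0) => /(_ w); rewrite in_set0 inE wC /= => wK.
    by move: wC; rewrite !inE wK => /andP[->].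
  have := leq_trans C2 (subset_leq_card CD).
  rewrite cardsDS; last by apply/subsetP => w; rewrite !inE => /andP[/(subsetP KS) -> ->].
  by have := high v vK; have := deg4 v vS; lia.
have degK a : #|nbr_in S a| <= 3 -> #|nbr_in K a| <= 3.
  exact/leq_trans/card_nbr_in_sub.
have [YK0|[y /setIP[yY yK]]] := set_0Vmem (Y :&: K).
  have [->|[v vK]] := set_0Vmem K; first exact: dec0.
  have [a [aK da]] : exists a, a \in K /\ #|nbr_in S a| <= 3.
    have [|dv] := leqP #|nbr_in S v| 3; first by exists v.
    by have [a [aK _ da]] := cubic v vK dv; exists a.
  have [b] : exists b, b \in nbr_in K a.
    by apply/card_gt0P; apply: leq_trans (high a aK).
  rewrite inE => /andP[bK eab].
  apply: (@dec_sub _ set0); first by rewrite YK0.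
  apply: (@dec_match _ _ a b); rewrite ?inE ?degK //.
  apply: dec_proper => [||y]; first by rewrite properD1.
    by rewrite setU0 cards1.
  rewrite !inE orbF => /eqP -> _; exists a; last by rewrite symE.
  by rewrite !inE eqxx (subsetP KS).
have [z] := Yout y yY yK; rewrite !inE => /andP[zK zS] eyz.
have {Y1 Yout yY}-> : Y = [set y].
  by apply/esym/eqP; rewrite eqEcard sub1set yY cards1.
have yS := subsetP KS y yK.
(* The removed neighbour [z], added to at least three neighbours in [K], gives [y] degree 4 in [S],
   so that [cubic] applies. *)
have dKy : #|nbr_in K y| < #|nbr_in S y|.
  apply: proper_card; apply/properP; split.
    by apply/subsetP => w; rewrite !inE => /andP[/(subsetP KS) -> ->].
  by exists z; rewrite !inE ?zS ?eyz // (negbTE zK).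
have [a [aK eya da]] := cubic y yK (leq_ltn_trans (high y yK) dKy).
have neq_ay : a != y by apply: contraTneq eya => ->; rewrite irrE.
have [b] : exists b, b \in nbr_in K a :\ y.
  by apply/card_gt0P; have := high a aK; rewrite (cardsD1 y); lia.
rewrite !inE => /and3P[neq_by bK eab].
apply: (@dec_match _ _ a b); rewrite ?inE ?degK //.
(* After [a], the vertex [y] goes too; [b] becomes the only protected vertex, with removed neighbour
   [a]. *)
rewrite setUC; apply: dec_low_degree; first by rewrite !inE eq_sym neq_ay.
  have := deg4 y yS; move: dKy; rewrite (cardsD1 a (nbr_in K y)) inE aK eya /=.
  suff -> : nbr_in K y :\ a = nbr_in (K :\ a) y by lia.
  by apply/setP => w; rewrite !inE andbA.
apply: dec_proper => [||c]; rewrite ?cards1 //.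
  by apply: sub_proper_trans (subsetDl _ _) _; rewrite properD1.
rewrite !inE => /eqP -> _; exists a; last by rewrite symE.
by rewrite !inE eqxx neq_ay (subsetP KS).
Qed.
End Decomposition.

(** * Components and added edges *)

Section Components.

Variable T : finType.
Implicit Types (e r : rel T) (A : {pred T}) (a b x y : T).

Lemma leq_card_inj (T' : finType) (A : {pred T}) (B : {pred T'}) (h : T -> T') :
  {in A &, injective h} -> {in A, forall x, h x \in B} -> #|A| <= #|B|.
Proof.
move=> injh hAB; rewrite -(card_in_imset injh).
by apply/subset_leq_card/subsetP => _ /imsetP[x xA ->]; exact: hAB.
Qed.

(** As [r] is the coarser relation, distinct [r]-roots lie in distinct [e]-components. *)
Lemma leq_n_comp e r A :
    connect_sym e -> connect_sym r -> closed e A -> subrel e (connect r) ->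
  n_comp r A <= n_comp e A.
Proof.
move=> syme symr clA er; have {}er := connect_sub er.
rewrite /n_comp_mem; apply: (@leq_card_inj _ _ _ (root e)) => [x y|x] /=; rewrite !inE.
  move=> /andP[/eqP rx _] /andP[/eqP ry _] /(rootP syme) /er /(rootP symr).
  by rewrite rx ry.
by move=> /andP[_ xA]; rewrite roots_root //= -(closed_connect clA (connect_root e x)).
Qed.

Definition add_link r a b : rel T :=
  [rel x y | [|| r x y, (x == a) && (y == b) | (x == b) && (y == a)]].

Lemma add_link_sym r a b : symmetric r -> symmetric (add_link r a b).
Proof.
move=> symr x y; rewrite /add_link /= symr; case: (r y x) => //=.
by rewrite orbC; congr orb; rewrite andbC.
Qed.

Lemma connect_add_link r a b x y : connect_sym r ->
  connect (add_link r a b) x y ->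
  [|| connect r x y, connect r x a && connect r y b
    | connect r x b && connect r y a].
Proof.
move=> symr /connectP[p]; elim: p x => [|z p IHp] x /=.
  by move=> _ ->; rewrite connect0.
case/andP=> xz /IHp{}IHp /IHp{IHp}; case/or3P: xz.
- move/(same_connect1 symr) => xz; rewrite !xz //.
- case/andP=> /eqP -> /eqP ->; case/or3P=> [|/andP[_]|/andP[_]].
  + by rewrite connect0 [connect r y b]symr => ->; rewrite orbT.
  + by rewrite connect0 => ->; rewrite orbT.
  + by rewrite [connect r y a]symr => ->.
- case/andP=> /eqP -> /eqP ->; case/or3P=> [|/andP[_]|/andP[_]].
  + by rewrite connect0 [connect r y a]symr => ->; rewrite !orbT.
  + by rewrite [connect r y b]symr => ->.
  + by rewrite connect0 => ->; rewrite !orbT.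
Qed.

(** Only the components of [a] and [b] can merge, so the old roots other than that of [b] stay in
    distinct components. *)
Lemma n_comp_add_link r A a b :
    symmetric r -> closed r A -> a \in A -> b \in A ->
  n_comp r A <= (n_comp (add_link r a b) A).+1.
Proof.
move=> symr0 clA aA bA; have symr := sym_connect_sym symr0.
have symr' := sym_connect_sym (@add_link_sym r a b symr0).
have clA' : closed (add_link r a b) A.
  move=> x y /or3P[/clA //||] /andP[/eqP -> /eqP ->]; rewrite -[LHS]/(_ \in A).
    by rewrite -[RHS]/(b \in A) aA bA.
  by rewrite -[RHS]/(a \in A) aA bA.
rewrite /n_comp_mem (cardD1 (root r b)) -add1n; apply: leq_add; first by case: (_ \in _).
apply: (@leq_card_inj _ _ _ (root (add_link r a b))) => [x y|x] /=; rewrite !inE.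
  move=> /and3P[xb /eqP rx _] /and3P[yb /eqP ry _].
  move/(rootP symr')/(connect_add_link symr); case/or3P.
  - by move/(rootP symr); rewrite rx ry.
  - by case/andP=> _ /(rootP symr); rewrite ry => yb'; rewrite yb' eqxx in yb.
  - by case/andP=> /(rootP symr); rewrite rx => xb'; rewrite xb' eqxx in xb.
by case/and3P=> _ _ xA; rewrite roots_root //= -(closed_connect clA' (connect_root _ x)).
Qed.

(** The new roots inject into the old ones, and the merged component accounts for two old roots, one
    of which, [m], is missed. *)
Lemma n_comp_add_bridge r A a b :
    symmetric r -> closed r A -> a \in A -> b \in A -> ~~ connect r a b ->
  n_comp (add_link r a b) A < n_comp r A.
Proof.
move=> symr0 clA aA bA nab; have symr := sym_connect_sym symr0.
set r' := add_link r a b.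
have symr' : connect_sym r' by exact/sym_connect_sym/add_link_sym.
have rr' : subrel (connect r) (connect r').
  by apply: connect_sub => x y xy; apply: connect1; rewrite /r' /add_link /= xy.
have ab : connect r' a b by apply: connect1; rewrite /r' /add_link /= !eqxx orbT.
have rab : root r' a = root r' b by apply/(rootP symr').
pose h := root r; pose m := if h a == h (root r' a) then h b else h a.
have mh : m != h (root r' a).
  rewrite /m; case: ifPn => // /eqP <-; apply: contra nab => /eqP/esym.
  by move/(rootP symr).
have mA : m \in [predI roots r & A].
  by rewrite inE /m /h; case: ifP => _;
    rewrite !inE roots_root //= -(closed_connect clA (connect_root _ _)).
rewrite /n_comp_mem [X in _ < X](cardD1 m) mA ltnS.
apply: (@leq_card_inj _ _ _ h) => [x y|x] /=; rewrite !inE.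
  move=> /andP[/eqP rx _] /andP[/eqP ry _] /(rootP symr) /rr' /(rootP symr').
  by rewrite rx ry.
case/andP=> /eqP rx xA; rewrite roots_root //= -(closed_connect clA (connect_root _ x)) xA.
rewrite andbT; apply: contra mh => /eqP hx; suff -> : root r' a = x by rewrite hx.
rewrite -rx; move: hx; rewrite /m; case: ifP => _ /esym/(rootP symr)/rr'/(rootP symr') //.
by rewrite rab.
Qed.

End Components.

Lemma even_involution (T : finType) (A : {set T}) (g : T -> T) :
    involutive g -> {in A, forall x, g x \in A} -> {in A, forall x, g x != x} ->
  ~~ odd #|A|.
Proof.
move=> gg; elim: {A}_.+1 {-2}A (ltnSn #|A|) => // n IHn A leAn gA gx.
have [->|[x xA]] := set_0Vmem A; first by rewrite cards0.
have gxA : g x \in A :\ x by rewrite !inE gx // gA.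
rewrite (cardsD1 x) xA (cardsD1 (g x)) gxA /= negbK.
apply: IHn => [|y|y].
- by move: leAn; rewrite (cardsD1 x) xA (cardsD1 (g x)) gxA; lia.
- rewrite !inE => /and3P[yg yx yA].
  by rewrite gA // andbT (inj_eq (inv_inj gg)) yx (inv_eq gg).
- by rewrite !inE => /and3P[_ _ /gx].
Qed.

(** * Faces under edge deletion *)

Section EdgeDeletion.

Variables (U : finType) (e : rel U) (M : embedding_scheme e).
Hypothesis e_simple : simple_graph e.
Implicit Types (f : rel U) (u v w : U) (x y z : flag U) (s : bool).

Let e_sym : symmetric e. Proof. by case: e_simple. Qed.
Let e_irr : irreflexive e. Proof. by case: e_simple. Qed.

Lemma along_edgeK : involutive (along_edge M).
Proof.
by case=> [[v w] s] /=; rewrite twisted_sym; case: (twisted M v w); rewrite ?negbK.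
Qed.

Lemma across_cornerK : involutive (across_corner M).
Proof. by case=> [[v w] []] /=; rewrite ?permK ?permKV. Qed.

Lemma across_corner_neq x : across_corner M x != x.
Proof. by case: x => [[v w] []]; apply/negP => /eqP []. Qed.

Lemma rotation_nbr v w : e v (rotation M v w) = e v w.
Proof.
have rw : rotation M v w \in porbit (rotation M v) w by rewrite (mem_porbit _ 1).
apply/idP/idP => evw; last by move: rw; rewrite rotation_cyclic // inE.
by move: rw; rewrite porbit_sym rotation_cyclic // inE.
Qed.

Lemma is_flag_across x : is_flag e (across_corner M x) = is_flag e x.
Proof.
case: x => [[v w] []]; rewrite /is_flag /= ?rotation_nbr //.
by rewrite -[in RHS](permKV (rotation M v) w) rotation_nbr.
Qed.

Lemma is_flag_along x : is_flag e (along_edge M x) = is_flag e x.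
Proof. by case: x => [[v w] s]; rewrite /is_flag /= e_sym. Qed.

Lemma same_face_closed : closed (same_face M) (is_flag e).
Proof.
move=> x y xy; rewrite -[LHS]/(is_flag e x) -[RHS]/(is_flag e y).
by case/orP: xy => /eqP ->; rewrite ?is_flag_along ?is_flag_across.
Qed.

Lemma same_face_sym : connect_sym (same_face M).
Proof.
apply: sym_connect_sym => x y; rewrite /same_face.
rewrite eq_sym (inv_eq along_edgeK); congr orb.
by rewrite eq_sym (inv_eq across_cornerK).
Qed.

(* The faces left after deleting from [e] the edges outside [f]: the two      *)
(* sides of a deleted half-edge are joined to each other at its vertex. All   *)
(* flags of [e] are kept, so that a vertex isolated by the deletion still has *)
(* its own face.                                                              *)
Definition along f x : flag U :=
  if f x.1.1 x.1.2 || ~~ is_flag e x then along_edge M x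
  else (x.1, ~~ x.2).

Definition face_step f : rel (flag U) :=
  [rel x y | (y == along f x) || (y == across_corner M x)].

Lemma alongK f : symmetric f -> involutive (along f).
Proof.
move=> symf x; have [fx|nfx] := boolP (f x.1.1 x.1.2 || ~~ is_flag e x).
  have -> : along f x = along_edge M x by rewrite /along fx.
  rewrite /along is_flag_along (_ : f _ _ = f x.1.1 x.1.2) ?fx ?along_edgeK //.
  by case: x {fx} => [[v w] s] /=; rewrite symf.
have -> : along f x = (x.1, ~~ x.2) by rewrite /along (negbTE nfx).
by rewrite /along /is_flag /= (negbTE nfx) negbK; case: x {nfx}.
Qed.

Lemma along_neq f x : is_flag e x -> along f x != x.
Proof.
rewrite /along => ex; rewrite ex orbF; case: x ex => [[v w] s] /= ex.
case: ifP => _; apply/eqP => -[]; last by case: (s).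
by move=> wv _ _; rewrite /is_flag /= wv e_irr in ex.
Qed.

Lemma is_flag_along' f x : is_flag e (along f x) = is_flag e x.
Proof. by rewrite /along; case: ifP => _; rewrite ?is_flag_along. Qed.

Lemma face_step_sym f : symmetric f -> symmetric (face_step f).
Proof.
move=> symf x y; rewrite /face_step /=.
by rewrite [y == _]eq_sym [y == across_corner _ _]eq_sym (inv_eq (alongK symf)) (inv_eq across_cornerK).
Qed.

Lemma face_step_closed f : closed (face_step f) (is_flag e).
Proof.
move=> x y xy; rewrite -[LHS]/(is_flag e x) -[RHS]/(is_flag e y).
by case/orP: xy => /eqP ->; rewrite ?is_flag_along' ?is_flag_across.
Qed.

Section AddEdge.

Variables (f : rel U) (u v : U).
Hypotheses (f_sym : symmetric f) (euv : e u v) (nfuv : ~~ f u v).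

Let g := add_link f u v.
Let g_sym : symmetric g. Proof. exact: add_link_sym. Qed.
Let special x := (x.1 == (u, v)) || (x.1 == (v, u)).

Let along_special x : special x -> (along f x = (x.1, ~~ x.2)) * (along g x = along_edge M x).
Proof.
case: x => [[a b] s]; rewrite /special /=.
have nfvu : ~~ f v u by rewrite f_sym.
case/orP=> /eqP[-> ->]; rewrite /along /is_flag /g /add_link /=.
  by rewrite (negbTE nfuv) euv !eqxx orbT.
by rewrite (negbTE nfvu) e_sym euv !eqxx !orbT.
Qed.

Let along_nonspecial x : ~~ special x -> along f x = along g x.
Proof.
case: x => [[a b] s]; rewrite /special /= !xpair_eqE => nx.
suff eq_fg : f a b = g a b by rewrite /along /= eq_fg.
by rewrite /g /add_link /= (negbTE nx) orbF.
Qed.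

Let special_along x : special (along_edge M x) = special x.
Proof.
by case: x => [[a b] s]; rewrite /special /= !xpair_eqE orbC; congr orb; rewrite andbC.
Qed.

(** The two step relations differ only at the four flags of the edge [uv]. Following that edge in
    [g] carries a link between its sides at [u] to its sides at [v], so linking at [u] suffices. *)
Let sub_face_step r : connect_sym r ->
    subrel (face_step g) (connect r) ->
    (forall s, connect r (u, v, s) (u, v, ~~ s)) ->
  subrel (face_step f) (connect r).
Proof.
move=> r_sym rg ruv.
have ralong x : connect r x (along g x) by apply: rg; rewrite /face_step /= eqxx.
move=> x y /orP[/eqP->|/eqP ->]; last by apply: rg; rewrite /face_step /= eqxx orbT.
have [sx|nx] := boolP (special x); last by rewrite along_nonspecial.
rewrite (along_special sx).1; case: x sx => [[a b] s] sx.
case/orP: (sx) => /eqP[eqa eqb]; first by rewrite eqa eqb; exact: ruv.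
have sx' : special (a, b, ~~ s) by [].
apply: (connect_trans (ralong _)); rewrite r_sym.
apply: (connect_trans (ralong _)).
rewrite (along_special sx).2 (along_special sx').2 /= eqa eqb.
by case: ifP => _; rewrite r_sym; exact: ruv.
Qed.

(** Linking the two sides of [uv] at [u] makes the faces of [g] coarser than those of [f], and one
    link merges at most two classes. *)
Lemma n_comp_face_add_edge :
  n_comp (face_step (add_link f u v)) (is_flag e)
    <= (n_comp (face_step f) (is_flag e)).+1.
Proof.
rewrite -/g.
have fl s : (u, v, s) \in is_flag e by rewrite unfold_in /is_flag.
apply: leq_trans (n_comp_add_link (face_step_sym g_sym) (@face_step_closed g) (fl true) (fl false)) _.
set r := add_link _ _ _; rewrite ltnS.
have r_sym : connect_sym r by exact/sym_connect_sym/add_link_sym/face_step_sym.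
apply: leq_n_comp => //; first exact/sym_connect_sym/face_step_sym.
  exact: face_step_closed.
apply: sub_face_step => // [x y xy|s].
  by apply: connect1; rewrite /r /add_link /= xy.
have ab : connect r (u, v, true) (u, v, false).
  by apply: connect1; rewrite /r /add_link /= !eqxx orbT.
by case: s => //=; rewrite r_sym.
Qed.

Let connect_vertex x y :
  x \in is_flag e -> connect (face_step f) x y -> connect f x.1.1 y.1.1.
Proof.
move=> ex /connectP[p]; elim: p x ex => [|z p IHp] x ex /=.
  by move=> _ ->; exact: connect0.
case/andP=> xz /IHp{}IHp /IHp{}IHp.
have ez : z \in is_flag e by rewrite -(face_step_closed xz).
have {}ex : is_flag e x := ex.
apply: connect_trans (IHp ez); case/orP: xz => /eqP ->.
  rewrite /along ex orbF; case: ifP => // fx; apply: connect1.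
  by case: (x) fx => [[a b] s].
by case: (x) => [[a b] []] /=; exact: connect0.
Qed.

(* In the absence of the links along the edge, the face piece containing one  *)
(* side of a bridge stays at the end [u], where the other side at [u] is the  *)
(* only place at which it can end; otherwise both [across_corner] and, except *)
(* for one flag, [along g] would be perfect matchings of this piece.          *)
Let bridge_face : ~~ connect f u v -> connect (face_step g) (u, v, true) (u, v, false).
Proof.
move=> nuv; pose a : flag U := (u, v, true); pose b : flag U := (u, v, false).
pose r : rel (flag U) :=
  [rel x y | (y == across_corner M x) || ~~ special x && (y == along g x)].
have special_g x : special (along g x) = special x.
  have [sx|nx] := boolP (special x); first by rewrite (along_special sx).2 special_along.
  apply/negbTE; apply: contra nx; move=> sgx; rewrite -(alongK g_sym x).
  by rewrite (along_special sgx).2 special_along.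
have r_sym : connect_sym r.
  apply: sym_connect_sym => x y; rewrite /r /=; congr orb.
    by rewrite eq_sym (inv_eq across_cornerK).
  by apply/andP/andP => -[nx /eqP ->]; rewrite special_g (alongK g_sym).
have rg : subrel (connect r) (connect (face_step g)).
  apply: connect_sub => x y /orP[|/andP[_]] xy; apply: connect1;
  by rewrite /face_step /= xy ?orbT.
have rf : subrel (connect r) (connect (face_step f)).
  apply: connect_sub => x y /orP[xy|/andP[nx xy]]; apply: connect1.
    by rewrite /face_step /= xy orbT.
  by rewrite /face_step /= along_nonspecial ?xy.
apply: rg; apply: contraT => nab; pose C := [set x | connect r a x].
have fl s : (u, v, s) \in is_flag e by rewrite unfold_in /is_flag.
have C_flag x : x \in C -> is_flag e x.
  rewrite inE => /rf /(closed_connect (@face_step_closed f)); rewrite fl.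
  by move/esym.
have aC : a \in C by rewrite inE connect0.
have C_across x : x \in C -> across_corner M x \in C.
  rewrite !inE => /connect_trans; apply; apply: connect1.
  by rewrite /r /= eqxx.
have C_special x : x \in C -> special x -> x = a.
  rewrite inE; case: x => [[x y] s] ax /orP[] /eqP /= [eqx eqy]; last first.
    by have := connect_vertex (fl true) (rf _ _ ax); rewrite /= eqx (negbTE nuv).
  by move: ax; rewrite eqx eqy; case: s => //; rewrite (negbTE nab).
have := @even_involution _ C _ across_cornerK C_across (in1W (@across_corner_neq)).
rewrite (cardsD1 a) aC /= negbK => /negP[].
apply/negP; apply: (@even_involution _ (C :\ a) _ (alongK g_sym)) => x; last first.
  by rewrite !inE => /andP[_ xC]; apply: along_neq; apply: C_flag; rewrite inE.
rewrite in_setD1 => /andP[xa xC].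
have nx : ~~ special x by apply: contra xa => /(C_special x xC)/eqP.
rewrite in_setD1; apply/andP; split.
  apply: contraNneq nx => ga; rewrite -special_g ga /special eqxx //.
move: xC; rewrite !inE => /connect_trans; apply; apply: connect1.
by rewrite /r /= nx eqxx orbT.
Qed.

(** The ends of a bridge lie on different face pieces of [f]. Linking them merges two pieces, and
    the result still refines the faces of [g], where by [bridge_face] both sides of the bridge lie
    on one face. *)
Lemma n_comp_face_add_bridge : ~~ connect f u v ->
  n_comp (face_step (add_link f u v)) (is_flag e)
    < n_comp (face_step f) (is_flag e).
Proof.
rewrite -/g.
move=> nuv; pose a : flag U := (u, v, true); pose c := along g a.
have sa : special a by rewrite /special eqxx.
have fl x : special x -> x \in is_flag e.
  by rewrite unfold_in /is_flag => /orP[] /eqP ->; rewrite // e_sym.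
have sc : special c by rewrite /c (along_special sa).2 special_along.
have nac : ~~ connect (face_step f) a c.
  apply: contra nuv => /(connect_vertex (fl _ sa)).
  by rewrite /c (along_special sa).2.
apply: leq_ltn_trans (n_comp_add_bridge (face_step_sym f_sym) (@face_step_closed f) (fl a sa) (fl c sc) nac).
set r := add_link _ _ _.
have r_sym : symmetric r by exact/add_link_sym/face_step_sym.
have g_csym : connect_sym (face_step g) by exact/sym_connect_sym/face_step_sym.
apply: leq_n_comp => //; first exact: sym_connect_sym.
  move=> x y /or3P[/face_step_closed //| |] /andP[/eqP -> /eqP ->].
    by rewrite -[LHS]/(a \in _) -[RHS]/(c \in _) !fl.
  by rewrite -[LHS]/(c \in _) -[RHS]/(a \in _) !fl.
move=> x y /or3P[xy| |]; last 2 first.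
- by case/andP=> /eqP -> /eqP ->; apply: connect1; rewrite /face_step /= eqxx.
- case/andP=> /eqP -> /eqP ->; rewrite g_csym; apply: connect1.
  by rewrite /face_step /= eqxx.
apply: sub_face_step xy => // [{}x {}y xy|s]; first exact: connect1.
by case: s => /=; [|rewrite g_csym]; exact: bridge_face.
Qed.

End AddEdge.

End EdgeDeletion.

(** * Euler's inequality for subgraphs *)

Definition darts (T : finType) (e : rel T) : {set T * T} := [set d | e d.1 d.2].

Lemma card_darts_edges (T : finType) (e : rel T) :
  simple_graph e -> #|darts e| = (#|edges e|).*2.
Proof.
move=> [symE irrE]; rewrite -sum1_card.
rewrite (partition_big (fun d => [set d.1; d.2]) (mem (edges e))) /=; last first.
  case=> x y; rewrite !inE /= => exy; apply/existsP; exists x; apply/existsP.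
  by exists y; rewrite exy eqxx.
rewrite -muln2 -sum_nat_const; apply: eq_bigr => A; rewrite inE.
case/existsP=> x /existsP[y /andP[exy /eqP ->]].
have neq_xy : x != y by apply: contraTneq exy => ->; rewrite irrE.
rewrite (eq_bigl (mem [set (x, y); (y, x)])) => [|[a b]].
  by rewrite sum1_card cards2 xpair_eqE (negbTE neq_xy).
rewrite !inE /= !xpair_eqE; apply/andP/idP => [[eab /eqP/setP eqA]|].
  have neq_ab : a != b by apply: contraTneq eab => ->; rewrite irrE.
  have := eqA a; have := eqA b; rewrite !inE !eqxx orbT /= => /esym bA /esym aA.
  case/orP: aA bA neq_ab => /eqP -> /orP[] /eqP ->; rewrite ?eqxx ?orbT //.
by case/orP=> /andP[/eqP -> /eqP ->]; rewrite ?exy // symE exy setUC.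
Qed.

Section EulerInequality.

Variables (U : finType) (e : rel U) (M : embedding_scheme e).
Hypotheses (e_simple : simple_graph e) (e_connected : n_comp e predT = 1).
Hypothesis euler_ge0 : (0 <= euler_char M)%R.
Implicit Types (f : rel U).

Lemma connected_nbr v w a : e v w -> nbr e a != set0.
Proof.
have [symE _] := e_simple; have csym := sym_connect_sym symE.
move=> evw; apply/negP => /eqP a0.
have /connectP[[|b p] /=] : connect e a v.
  apply/(rootP csym); have /eq_leq/card_le1_eqP := e_connected.
  by apply; rewrite !inE roots_root.
  by move=> _ av; move: a0 => /setP/(_ w); rewrite !inE -av evw.
by case/andP=> eab _ _; move: a0 => /setP/(_ b); rewrite !inE eab.
Qed.

(** With c components this reads V - E + F >= 2c - 2. It holds for [e], where c = 1, and survives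
    deletions: deleting an edge whose ends stay connected loses at most one face, while deleting a
    bridge gains a face and at most one component. The edge [e v w] rules out isolated vertices of
    [e], which [nb_faces] counts apart. *)
Lemma euler_subgraph f v w : symmetric f -> subrel f e -> e v w ->
  4 * n_comp f predT + #|darts f| <=
  2 * n_comp (face_step M f) (is_flag e) + 2 * #|U| + 4.
Proof.
have [symE irrE] := e_simple.
elim: {f}_.+1 {-2}f (ltnSn #|darts e :\: darts f|) => // n IHn f len symf fe evw.
have csymf := sym_connect_sym symf.
have [D0|[[a b]]] := set_0Vmem (darts e :\: darts f); last first.
  rewrite !inE /= => /andP[nfab eab]; pose g := add_link f a b.
  have symg : symmetric g by exact: add_link_sym.
  have csymg := sym_connect_sym symg.
  have ge : subrel g e.
    by move=> x y /or3P[/fe //||] /andP[/eqP -> /eqP ->]; rewrite // symE.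
  have neq_ab : a != b by apply: contraTneq eab => ->; rewrite irrE.
  have dg : darts g = (a, b) |: ((b, a) |: darts f).
    by apply/setP => -[x y]; rewrite !inE /= !xpair_eqE /g /add_link /= orbC orbA.
  have nfba : ~~ f b a by rewrite symf.
  have Dg : #|darts g| = (#|darts f|).+2.
    by rewrite dg !cardsU1 !inE /= xpair_eqE (negbTE neq_ab) nfab nfba.
  have {}IHn : 4 * n_comp g predT + #|darts g| <=
      2 * n_comp (face_step M g) (is_flag e) + 2 * #|U| + 4.
    apply: IHn => //; rewrite -ltnS; apply: leq_trans len; rewrite ltnS; apply: proper_card.
    rewrite dg; apply/properP; split; first by rewrite setUA setDS ?subsetUr.
    by exists (a, b); rewrite !inE /= ?eqxx ?nfab.
  (* Primed quantities belong to [g], which has one more edge, hence two more darts. *)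
  have arith (c c' D m m' k : nat) : 4 * c' + D.+2 <= 2 * m' + k + 4 ->
      c <= c' /\ m' <= m.+1 \/ c <= c'.+1 /\ m' < m -> 4 * c + D <= 2 * m + k + 4.
    lia.
  apply: arith; first by rewrite -Dg; exact: IHn.
  have [cab|ncab] := boolP (connect f a b); [left|right]; split.
  - apply: leq_n_comp => // x y /or3P[|/andP[/eqP-> /eqP->] //|/andP[/eqP-> /eqP->]].
      exact: connect1.
    by rewrite csymf.
  - exact: n_comp_face_add_edge.
  - exact: n_comp_add_link.
  - exact: n_comp_face_add_bridge.
have eq_fe : f =2 e.
  move=> x y; apply/idP/idP => [/fe //|exy]; apply: contraT => nfxy.
  by move/setP: D0 => /(_ (x, y)); rewrite !inE nfxy exy.
have -> : #|darts f| = (#|edges e|).*2.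
  by rewrite -card_darts_edges //; apply: eq_card => d; rewrite !inE eq_fe.
have -> : n_comp f predT = 1.
  by rewrite -e_connected; apply: eq_n_comp; exact: eq_connect.
have -> : n_comp (face_step M f) (is_flag e) = n_comp (same_face M) (is_flag e).
  apply: eq_n_comp; apply: eq_connect => x y.
  by rewrite /face_step /same_face /along /is_flag /= eq_fe orbN.
have no_isolated : [set x | nbr e x == set0] = set0.
  by apply/setP => x; rewrite !inE (negbTE (connected_nbr x evw)).
move: euler_ge0; rewrite /euler_char /nb_faces no_isolated cards0 addn0; lia.
Qed.

End EulerInequality.

(** * The embedding scheme of a subgraph *)

Section InducedScheme.

Variables (U : finType) (e : rel U) (M : embedding_scheme e).
Hypothesis e_simple : simple_graph e.
Variable f : rel U.
Hypotheses (f_sym : symmetric f) (f_sub : subrel f e).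

Lemma sub_simple : simple_graph f.
Proof.
have [_ irrE] := e_simple; split=> // v; apply: negbTE; apply/negP => /f_sub.
by rewrite irrE.
Qed.

(** Deletion keeps the cyclic order of the remaining neighbours; as a duplicate-free list, this
    order yields a permutation through [next], even at vertices isolated in [f]. *)
Definition sub_nbrs v : seq U :=
  if [pick w | f v w] is Some w then [seq x <- orbit (rotation M v) w | f v x]
  else [::].

Lemma sub_nbrs_uniq v : uniq (sub_nbrs v).
Proof.
by rewrite /sub_nbrs; case: pickP => // w _; rewrite filter_uniq // orbit_uniq.
Qed.

Lemma mem_orbit_rotation v w x : e v w -> (x \in orbit (rotation M v) w) = e v x.
Proof.
move=> evw; rewrite -fconnect_orbit; have /setP/(_ x) := rotation_cyclic M evw.
rewrite inE => <-; apply/idP/porbitP => [/iter_findex <-|[i ->]].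
  by exists (findex (rotation M v) w x); rewrite permX.
by rewrite permX; exact: fconnect_iter.
Qed.

Lemma mem_sub_nbrs v x : (x \in sub_nbrs v) = f v x.
Proof.
rewrite /sub_nbrs; case: pickP => [w fvw|->//]; rewrite mem_filter.
rewrite (mem_orbit_rotation _ (f_sub fvw)); exact: andb_idr (@f_sub v x).
Qed.

Definition sub_rotation v : {perm U} :=
  perm (can_inj (prev_next (sub_nbrs_uniq v))).

Lemma sub_rotation_cyclic v w : f v w -> porbit (sub_rotation v) w = nbr f v.
Proof.
rewrite -mem_sub_nbrs => wv; apply/setP => x; rewrite inE -mem_sub_nbrs.
have rE : sub_rotation v =1 next (sub_nbrs v) by move=> y; rewrite permE.
rewrite -(fconnect_cycle (cycle_next (sub_nbrs_uniq v)) wv) -(eq_fconnect rE).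
apply/porbitP/idP => [[i ->]|/iter_findex <-].
  by rewrite permX; exact: fconnect_iter.
by exists (findex (sub_rotation v) w x); rewrite permX.
Qed.

Definition sub_scheme : embedding_scheme f :=
  EmbeddingScheme sub_rotation_cyclic (twisted_sym M).

Let r := face_step M f.
Let r_sym : connect_sym r. Proof. exact/sym_connect_sym/face_step_sym. Qed.

Let step_across v w : connect r (v, w, true) (v, rotation M v w, false).
Proof. by apply: connect1; rewrite /r /face_step /= eqxx orbT. Qed.

Let step_flip v w s : e v w -> ~~ f v w -> connect r (v, w, s) (v, w, ~~ s).
Proof.
move=> evw nfvw; apply: connect1; rewrite /r /face_step /along /is_flag /=.
by rewrite (negbTE nfvw) evw eqxx.
Qed.

(** Turning around [v] alternates crossing a corner with changing sides of a deleted half-edge, up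
    to the first [f]-neighbour. The default of [head] is the neighbour after the path, for when the
    path has no [f]-neighbour. *)
Let connect_fpath v w p : e v w -> fpath (rotation M v) w p ->
  connect r (v, w, true)
    (v, head (rotation M v (last w p)) [seq x <- p | f v x], false).
Proof.
elim: p w => [|x p IHp] w evw /=; first by move=> _; exact: step_across.
case/andP=> /eqP <-; have [fvx _|nfvx /IHp{}IHp] := ifPn; first exact: step_across.
have evx : e v (rotation M v w) by rewrite rotation_nbr.
apply: connect_trans (step_across v w) _; apply: connect_trans (IHp evx).
exact: step_flip nfvx.
Qed.

(** A corner of the subscheme is a run of corners of [M] separated by deleted half-edges, whose two
    sides are joined. *)
Lemma sub_rotation_connect v w : f v w ->
  connect (face_step M f) (v, w, true) (v, sub_rotation v w, false).
Proof.
move=> fvw; rewrite permE; have wv : w \in sub_nbrs v by rewrite mem_sub_nbrs.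
move: wv (sub_nbrs_uniq v); rewrite /sub_nbrs; case: pickP => // w0 fvw0.
have evw := f_sub fvw; have evw0 := f_sub fvw0.
set o := orbit _ _ => wo Uo.
have wo' : w \in o by rewrite mem_orbit_rotation.
(* With the orbit rotated to start at [w], the [next] of [w] in the filtered list is the head of the
   filtered rest, or [w] itself if that is empty. *)
have [i p def_o] := rot_to wo'.
have : fcycle (rotation M v) (rot i o) by rewrite rot_cycle; exact/cycle_orbit/perm_inj.
rewrite def_o /= rcons_path => /andP[rp /eqP rl].
have : rot (size [seq x <- take i o | f v x]) [seq x <- o | f v x] =
       w :: [seq x <- p | f v x].
  rewrite -{2}[o](cat_take_drop i) filter_cat rot_size_cat -filter_cat.
  by rewrite -[drop _ _ ++ _]/(rot i o) def_o /= fvw.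
move/(congr1 (fun s => next s w)); rewrite (next_rot _ Uo) => ->.
have := connect_fpath evw rp; rewrite rl.
by case: [seq x <- p | f v x] => [|y s] /=; rewrite eqxx.
Qed.

Lemma same_face_sub_scheme x y :
  is_flag f x -> connect (same_face sub_scheme) x y -> connect r x y.
Proof.
move=> fx /connectP[p]; elim: p x fx => [|z p IHp] x fx /=.
  by move=> _ ->; exact: connect0.
case/andP=> xz /IHp{}IHp /IHp{}IHp.
have fz : is_flag f z.
  by rewrite -[is_flag f z]/(z \in is_flag f) -(same_face_closed sub_simple xz).
apply: connect_trans (IHp fz); case/orP: xz => /eqP -> {z IHp fz}.
  apply: connect1; case: x fx => [[v w] s]; rewrite /is_flag /= => fvw.
  by rewrite /r /face_step /along /= fvw eqxx.
have := fx; rewrite -(is_flag_across sub_scheme).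
case: x fx => [[v w] []]; rewrite /is_flag /= => fvw fvw'.
  exact: sub_rotation_connect.
by rewrite r_sym -{2}[w](permKV (sub_rotation v)); exact: sub_rotation_connect.
Qed.

(** Turning around [v] can only be stopped by a half-edge of [f]. *)
Let connect_around v w s k : e v w ->
  (exists x t, f v x /\ connect r (v, w, s) (v, x, t)) \/
  connect r (v, w, s) (v, iter k (rotation M v) w, true).
Proof.
move=> evw; elim: k => [|k [IHk|IHk]] /=; [|by left|].
  case: s; first by right; exact: connect0.
  have [fvw|nfvw] := boolP (f v w); last by right; exact: step_flip.
  by left; exists w, false; split; last exact: connect0.
set x := iter k _ w in IHk *; have := connect_trans IHk (step_across v x).
set x' := rotation M v x => cx'.
have evx' : e v x'.
  by rewrite /x' rotation_nbr /x; elim: (k) => //= j; rewrite rotation_nbr.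
have [fvx'|nfvx'] := boolP (f v x'); first by left; exists x', false.
by right; apply: connect_trans cx' _; exact: step_flip.
Qed.

(** A piece with root at a vertex not isolated in [f] contains a flag of [f], and distinct such
    pieces give distinct faces by [same_face_sub_scheme]. At a vertex isolated in [f] all flags form
    one piece, sent to that vertex. *)
Lemma leq_n_comp_nb_faces :
  n_comp (face_step M f) (is_flag e) <= nb_faces sub_scheme.
Proof.
have around v w x : e v w -> e v x -> exists k, x = iter k (rotation M v) w.
  move=> evw evx; have : x \in porbit (rotation M v) w.
    by rewrite rotation_cyclic // inE.
  by case/porbitP=> k ->; exists k; rewrite permX.
have s_sym := same_face_sym sub_scheme.
pose P : pred (flag U) := fun x => nbr f x.1.1 == set0.
rewrite /n_comp_mem -(cardID P) addnC; apply: leq_add.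
  pose F x := odflt x [pick z | is_flag f z && connect r x z].
  have FP x : is_flag e x -> ~~ P x -> is_flag f (F x) && connect r x (F x).
    move=> ex /set0Pn[w]; rewrite inE => fvw; rewrite /F; case: pickP => //= none.
    case: x ex fvw none => [[v w'] s]; rewrite /is_flag /= => evw' fvw none.
    have [k wk] := around _ _ _ evw' (f_sub fvw).
    have [[x [t [fvx cx]]]|] := @connect_around v w' s k evw'.
      by have := none (v, x, t); rewrite fvx cx.
    by rewrite -wk => cx; have := none (v, w, true); rewrite fvw cx.
  apply: (@leq_card_inj _ _ _ _ (fun x => root (same_face sub_scheme) (F x))).
    move=> x y /andP[nPx /andP[/eqP rx ex]] /andP[nPy /andP[/eqP ry ey]].
    have /andP[fx cx] := FP x ex nPx; have /andP[fy cy] := FP y ey nPy.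
    move/(rootP s_sym)/(same_face_sub_scheme fx)/(connect_trans cx).
    move/connect_trans/(_ _)/(rootP r_sym) => /(_ y); rewrite rx ry; apply.
    by rewrite r_sym.
  move=> x /andP[nPx /andP[_ ex]]; have /andP[fx _] := FP x ex nPx.
  rewrite inE /= roots_root //=.
  by rewrite -(closed_connect (same_face_closed sub_simple) (connect_root _ (F x))).
apply: (@leq_card_inj _ _ _ _ (fun x => x.1.1)) => [x y|x]; last first.
  by case/andP=> _ Px; rewrite inE.
move=> /andP[/andP[/eqP rx ex] /eqP Px] /andP[/andP[/eqP ry ey] _] eq_v.
suff : connect r x y by move/(rootP r_sym); rewrite rx ry.
have same v w w' s s' : nbr f v = set0 -> e v w -> e v w' ->
    connect r (v, w, s) (v, w', s').
  move=> v0 evw evw'; have nfv z : ~~ f v z.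
    by move/setP: v0 => /(_ z); rewrite !inE => ->.
  have [k wk] := around v w w' evw evw'.
  have [[z [t [fvz _]]]|] := @connect_around v w s k evw.
    by have := nfv z; rewrite fvz.
  rewrite -wk => cw; apply: connect_trans cw _; case: s'; first exact: connect0.
  exact: (step_flip true).
case: x {rx} ex Px eq_v => [[v w] s] /= evw v0; case: y {ry} ey => [[v' w'] s'] /= evw'.
by move=> eq_v; subst v'; exact: same v0 evw evw'.
Qed.

Hypotheses (e_connected : n_comp e predT = 1) (euler_ge0 : (0 <= euler_char M)%R).

(** In V - E + F >= 2c - 2 an isolated vertex of [f] counts once in V, at most once in F and once in
    c, so that it cancels; the component of [v] absorbs the constant. *)
Lemma darts_sub_scheme v w : f v w ->
  #|darts f| <= 2 * n_comp (same_face sub_scheme) (is_flag f)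
                + 2 * #|[set u | nbr f u != set0]|.
Proof.
move=> fvw; have csymf := sym_connect_sym f_sym.
have := euler_subgraph e_simple e_connected euler_ge0 f_sym f_sub (f_sub fvw).
have := leq_n_comp_nb_faces; rewrite /nb_faces.
set I := [set u | nbr f u == set0].
have -> : [set u | nbr f u != set0] = ~: I by apply/setP => u; rewrite !inE.
have := cardsC I.
have : #|I| < n_comp f predT.
  have nI : root f v \notin I.
    rewrite inE; apply/set0Pn; have := connect_root f v; rewrite csymf.
    case/connectP=> [[|a p] /=]; first by move=> _ <-; exists w; rewrite inE.
    by case/andP=> fa _ _; exists a; rewrite inE.
  rewrite -[#|I|.+1](_ : #|root f v |: I| = _); last by rewrite cardsU1 nI.
  apply/subset_leq_card/subsetP => u; rewrite !inE andbT => /orP[/eqP ->|/eqP u0].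
    exact: roots_root.
  have /connectP[[|a p] /= ] := connect_root f u; first by move=> _ /eqP.
  by case/andP=> fua _ _; move/setP: u0 => /(_ a); rewrite !inE fua.
lia.
Qed.

End InducedScheme.

(** * Lengths of faces *)

Section FaceLengths.

Variables (T : finType) (e : rel T) (M : embedding_scheme e).
Hypothesis e_simple : simple_graph e.
Implicit Types (v w : T) (x y z : flag T).

Let e_irr : irreflexive e. Proof. by case: e_simple. Qed.

Local Notation alpha := (along_edge M).
Local Notation beta := (across_corner M).

(** The flags of a face form two orbits of [face_walk], one for each direction, exchanged by
    [across_corner]; one orbit therefore measures the length of the face. *)
Definition face_walk x := beta (alpha x).
Definition face_length x := fingraph.order face_walk x.

Lemma face_walk_inj : injective face_walk.
Proof. exact: inj_comp (inv_inj (across_cornerK M)) (inv_inj (along_edgeK M)). Qed.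

Lemma is_flag_walk x : is_flag e (face_walk x) = is_flag e x.
Proof. by rewrite /face_walk is_flag_across is_flag_along. Qed.

Lemma is_flag_iter_walk i x : is_flag e (iter i face_walk x) = is_flag e x.
Proof. by elim: i => //= i IHi; rewrite is_flag_walk. Qed.

Lemma along_edge_neq x : is_flag e x -> alpha x != x.
Proof.
case: x => [[v w] s]; rewrite /is_flag /= => evw; apply/eqP => -[wv _ _].
by rewrite wv e_irr in evw.
Qed.

Lemma walk_across x : face_walk (beta (face_walk x)) = beta x.
Proof. by rewrite /face_walk across_cornerK along_edgeK. Qed.

(* Otherwise [alpha] or [beta] would fix a flag in the middle of the walk. *)
Lemma across_not_walk x i : is_flag e x -> beta x <> iter i face_walk x.
Proof.
elim: {i}_.+1 {-2}i x (ltnSn i) => // n IHn [|[|i]] x lti ex.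
- by move/eqP; rewrite (negbTE (across_corner_neq M x)).
- by move/(inv_inj (across_cornerK M))/esym/eqP; rewrite (negbTE (along_edge_neq ex)).
- rewrite iterS iterSr {1}/face_walk => /(inv_inj (across_cornerK M)) eq_x.
  apply: (IHn i (face_walk x)); rewrite ?is_flag_walk //; first by lia.
  by rewrite {1}/face_walk across_cornerK {1}eq_x along_edgeK.
Qed.

Lemma fconnect_walk_across x y :
  fconnect face_walk (beta x) (beta y) = fconnect face_walk x y.
Proof.
suff sub a b : fconnect face_walk a b -> fconnect face_walk (beta a) (beta b).
  by apply/idP/idP => /sub //; rewrite !across_cornerK.
move=> /iter_findex <-; elim: (findex _ _ _) => [|i IHi] /=; first exact: connect0.
apply: connect_trans IHi _; rewrite (fconnect_sym face_walk_inj).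
by rewrite -[X in fconnect _ _ X]walk_across; exact: fconnect1.
Qed.

Lemma face_length_across x : face_length (beta x) = face_length x.
Proof.
rewrite /face_length /fingraph.order -[LHS](card_image (inv_inj (across_cornerK M))).
apply: eq_card => y; rewrite -[y](across_cornerK M) (mem_image (inv_inj (across_cornerK M))).
by rewrite -[LHS]fconnect_walk_across !across_cornerK.
Qed.

Lemma face_length_walk x : face_length (face_walk x) = face_length x.
Proof.
by apply: eq_card => y; exact/esym/(same_fconnect1 face_walk_inj).
Qed.

Lemma face_length_along x : face_length (alpha x) = face_length x.
Proof. by rewrite -face_length_across [LHS]face_length_walk. Qed.

(** By [across_not_walk], the orbit of [x] is disjoint from its image under [across_corner]. *)
Lemma leq_card_face x : is_flag e x ->
  2 * face_length x <= #|connect (same_face M) x|.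
Proof.
move=> ex; pose A := [set y | fconnect face_walk x y].
have sAc y : y \in A -> connect (same_face M) x y.
  rewrite inE => /iter_findex <-; elim: (findex _ _ _) => [|i IHi] /=; first exact: connect0.
  apply: connect_trans IHi _; set y' := iter i _ x.
  by apply: (@connect_trans _ _ (alpha y')); apply: connect1;
    rewrite /same_face eqxx ?orbT.
have -> : face_length x = #|A| by apply: eq_card => y; rewrite !inE.
rewrite mul2n -addnn -{2}(card_imset (mem A) (inv_inj (across_cornerK M))).
rewrite -cardsUI [A :&: _](_ : _ = set0) ?cards0 ?addn0.
  apply/subset_leq_card/subsetP => y; rewrite in_setU => /orP[/sAc //|].
  case/imsetP=> z /sAc xz ->; apply: connect_trans xz _; apply: connect1.
  by rewrite /same_face eqxx orbT.
apply/setP => y; rewrite in_set0 in_setI; apply/andP => -[].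
rewrite inE => xy /imsetP[z]; rewrite inE => xz yz.
have ez : is_flag e z by rewrite -(iter_findex xz) is_flag_iter_walk.
have : fconnect face_walk z y by apply: connect_trans xy; rewrite (fconnect_sym face_walk_inj).
by move/iter_findex/esym; rewrite yz; exact: across_not_walk.
Qed.

Lemma face_length_same_face x y :
  connect (same_face M) x y -> face_length y = face_length x.
Proof.
case/connectP=> p; elim: p x => [|z p IHp] x /=; first by move=> _ ->.
case/andP=> xz /IHp{}IHp /IHp ->.
by case/orP: xz => /eqP ->; rewrite ?face_length_along ?face_length_across.
Qed.

End FaceLengths.

Import Order.TTheory GRing.Theory Num.Theory.

(** * The curvature sum *)

Section Curvature.

Variables (T : finType) (e : rel T) (M : embedding_scheme e).
Hypothesis e_simple : simple_graph e.
Implicit Types (v w : T) (x y z : flag T).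

Local Notation alpha := (along_edge M).
Local Notation beta := (across_corner M).
Local Notation len := (face_length M).
Local Notation deg x := (degree e x.1.1).
Local Open Scope ring_scope.

Lemma sum_flags_dart (F : T * T -> rat) :
  \sum_(x : flag T | is_flag e x) F x.1 = 2 * \sum_(d | e d.1 d.2) F d.
Proof.
transitivity (\sum_(d : T * T | e d.1 d.2) \sum_(b : bool) F d).
  by rewrite pair_big_dep /=; apply: eq_bigl => x; rewrite andbT.
by rewrite mulr_sumr; apply: eq_bigr => d _; rewrite big_bool /=; ring.
Qed.

Lemma sum_flags1 : \sum_(x : flag T | is_flag e x) 1 = 2 * #|darts e|%:R :> rat.
Proof.
by rewrite (sum_flags_dart (fun=> 1)) -sum1_card natr_sum; congr (_ * _); apply: eq_bigl => d; rewrite inE.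
Qed.

Lemma sum_flags_degree :
  \sum_(x : flag T | is_flag e x) (deg x)%:R^-1 =
    2 * #|[set u | nbr e u != set0]|%:R :> rat.
Proof.
rewrite (sum_flags_dart (fun d => (degree e d.1)%:R^-1)); congr (_ * _).
transitivity (\sum_v \sum_(w | e v w) (degree e v)%:R^-1 : rat).
  by rewrite pair_big_dep.
rewrite -sum1_card natr_sum big_mkcond [RHS]big_mkcond /=; apply: eq_bigr => v _.
rewrite sumr_const inE -cards_eq0 -[#|[eta e v]|](_ : degree e v = _); last first.
  by apply: eq_card => w; rewrite inE.
rewrite -/(degree e v); case: (degree e v) => [|n] /=; first by rewrite mulr0n.
by rewrite -[LHS]mulr_natr mulVf // pnatr_eq0.
Qed.

Lemma leq_n_comp_sum_length :
  2 * (n_comp (same_face M) (is_flag e))%:R <=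
    \sum_(x : flag T | is_flag e x) (len x)%:R^-1 :> rat.
Proof.
have csym := same_face_sym M; pose rt := root (same_face M).
have flag_rt x : is_flag e (rt x) = is_flag e x.
  exact: esym (closed_connect (same_face_closed e_simple) (connect_root _ x)).
rewrite (partition_big rt (mem [predI roots (same_face M) & is_flag e])) /=; last first.
  by move=> x ex; rewrite !inE roots_root //= [_ \in _]flag_rt.
rewrite /n_comp_mem -sum1_card natr_sum mulr_sumr; apply: ler_sum => z.
rewrite inE => /andP[/eqP rz ez]; rewrite mulr1.
rewrite (eq_big (connect (same_face M) z) (fun=> (len z)%:R^-1)) => [|x|x /andP[_ /eqP rx]].
- rewrite sumr_const -[leRHS]mulr_natr.
  have l0 : (0 < (len z)%:R :> rat) by rewrite ltr0n fingraph.order_gt0.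
  rewrite mulrC ler_pdivlMr // -natrM ler_nat; exact: leq_card_face.
- apply/andP/idP => [[_ /eqP rx]|zx].
    by rewrite -(root_connect csym) rz; apply/eqP.
  have rx : rt x = z by rewrite -rz; apply/esym/(rootP csym).
  by rewrite rx -[is_flag e x]flag_rt rx.
- congr (_%:R^-1); apply: face_length_same_face; apply/(rootP csym); rewrite rz; exact/esym.
Qed.

(** A vertex of degree d has 2d flags and a face of length l at least 2l, so the three terms sum to
    twice the number of darts, to 4V, and to at least 4F. *)
Lemma curvature_le0 :
    (#|darts e| <= 2 * n_comp (same_face M) (is_flag e)
                + 2 * #|[set u | nbr e u != set0]|)%N ->
  \sum_(x : flag T | is_flag e x) (1 - 2 / (deg x)%:R - 2 / (len x)%:R) <= 0 :> rat.
Proof.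
rewrite -(ler_nat rat) natrD !natrM => leD.
rewrite !big_split /= !sumrN -!mulr_sumr sum_flags1 sum_flags_degree.
by have := leq_n_comp_sum_length; lra.
Qed.

End Curvature.

(** * Short faces and short cycles *)

Section FaceCycles.

Variables (T : finType) (e : rel T) (M : embedding_scheme e).
Hypothesis e_simple : simple_graph e.
Hypothesis min_degree : forall v w, e v w -> 2 < degree e v.
Implicit Types (v w : T) (x y z : flag T).

Let e_sym : symmetric e. Proof. by case: e_simple. Qed.
Let e_irr : irreflexive e. Proof. by case: e_simple. Qed.

Local Notation alpha := (along_edge M).
Local Notation beta := (across_corner M).
Local Notation walk := (face_walk M).
Local Notation len := (face_length M).

Let e_neq v w : e v w -> v != w.
Proof. by apply: contraTneq => ->; rewrite e_irr. Qed.

Lemma cycle3 a b c : e a b -> e b c -> e c a -> has_cycle 3 e.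
Proof.
move=> ab bc ca; exists [:: a; b; c]; split=> //.
by rewrite /ucycle /= ab bc ca !inE negb_or (e_neq ab) (e_neq bc) eq_sym (e_neq ca).
Qed.

Lemma cycle4 a b c d :
  e a b -> e b c -> e c d -> e d a -> a != c -> b != d -> has_cycle 4 e.
Proof.
move=> ab bc cd da nac nbd; exists [:: a; b; c; d]; split=> //.
rewrite /ucycle /= ab bc cd da !inE !negb_or (e_neq ab) (e_neq bc) (e_neq cd).
by rewrite nac nbd eq_sym (e_neq da).
Qed.

Lemma cycle6 a b c d f g :
    e a b -> e b c -> e c d -> e d f -> e f g -> e g a ->
    [&& a != c, b != d, c != f, d != g, a != f & b != g] ->
    [&& a != d, b != f & c != g] -> has_cycle 6 e.
Proof.
move=> ab bc cd df fg ga /and5P[nac nbd ncf ndg /andP[naf nbg]] /and3P[nad nbf ncg].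
exists [:: a; b; c; d; f; g]; split=> //.
rewrite /ucycle /= ab bc cd df fg ga !inE !negb_or (e_neq ab) (e_neq bc) (e_neq cd).
rewrite (e_neq df) (e_neq fg) nac nbd ncf ndg nad nbf ncg.
by rewrite naf nbg (eq_sym a g) (e_neq ga).
Qed.

Lemma rotation_uniq v w : e v w ->
  uniq (traject (rotation M v) w (degree e v)).
Proof.
by move=> evw; rewrite /degree -(rotation_cyclic M evw) uniq_traject_porbit.
Qed.

Lemma rotation_neq v w : e v w -> rotation M v w != w.
Proof.
move=> evw; have := rotation_uniq evw; have := min_degree evw.
case: (degree e v) => [|[|n]] //= _; rewrite !inE !negb_or eq_sym.
by case/and3P=> /andP[].
Qed.

Lemma rotation2_neq v w : e v w -> rotation M v (rotation M v w) != w.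
Proof.
move=> evw; have := rotation_uniq evw; have := min_degree evw.
case: (degree e v) => [|[|[|n]]] //= _ /andP[]; rewrite !inE.
by case/norP=> _ /norP[nw _] _; rewrite eq_sym.
Qed.

Lemma walk_start x : (walk x).1.1 = x.1.2.
Proof. by case: x => [[v w] s]; rewrite /face_walk /=; case: ifP => _; case: s. Qed.

Lemma across_end_neq x : is_flag e x -> (beta x).1.2 != x.1.2.
Proof.
case: x => [[v w] s]; rewrite /is_flag /= => evw.
case: s => /=; first exact: rotation_neq.
by rewrite eq_sym -{1}[w](permKV (rotation M v)) rotation_neq // -(rotation_nbr M) permKV.
Qed.

Definition flip x : flag T := (x.1, ~~ x.2).

Lemma flipK : involutive flip.
Proof. by case=> d s; rewrite /flip /= negbK. Qed.

(** These are the neighbours just before and just after the end of [x] in the rotation, distinct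
    since the degree exceeds 2. *)
Lemma across_flip_neq x : is_flag e x -> (beta (flip x)).1.2 != (beta x).1.2.
Proof.
case: x => [[v w] s]; rewrite /is_flag /flip /= => evw.
have evw' : e v ((rotation M v)^-1%g w) by rewrite -(rotation_nbr M) permKV.
have := rotation2_neq evw'; rewrite permKV.
by case: s => //=; rewrite eq_sym.
Qed.

Lemma along_flip x : alpha (flip x) = flip (alpha x).
Proof. by case: x => [[v w] s]; rewrite /flip /=; case: ifP. Qed.

Lemma walk_flip_neq x : is_flag e x -> (walk (flip x)).1.2 != (walk x).1.2.
Proof.
by move=> ex; rewrite /face_walk along_flip across_flip_neq ?is_flag_along.
Qed.

Lemma iter_face_length x : iter (len x) walk x = x.
Proof. exact/iter_order/face_walk_inj. Qed.

Definition vtx x i := (iter i walk x).1.1.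

Lemma vtx_edge x i : is_flag e x -> e (vtx x i) (vtx x i.+1).
Proof.
move=> ex; rewrite /vtx iterS walk_start -[e _ _]/(is_flag e (iter i walk x)).
by rewrite is_flag_iter_walk.
Qed.

Lemma vtx_neq2 x i : is_flag e x -> vtx x i != vtx x i.+2.
Proof.
move=> ex; rewrite /vtx !iterS walk_start; set y := iter i walk x.
have ey : is_flag e y by rewrite is_flag_iter_walk.
rewrite eq_sym; have := across_end_neq (_ : is_flag e (alpha y)).
by rewrite is_flag_along // => /(_ ey); case: (y) => [[v w] s].
Qed.

Lemma vtx_length x i : vtx x (i + len x) = vtx x i.
Proof. by rewrite /vtx iterD iter_face_length. Qed.

Lemma vtx_last x : vtx x (len x).-1 = (beta x).1.2.
Proof.
have lx : (0 < len x)%N by exact: fingraph.order_gt0.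
rewrite /vtx; suff -> : iter (len x).-1 walk x = alpha (beta x).
  by case: (beta x) => [[v w] s].
apply: (@face_walk_inj _ _ M); rewrite -iterS prednK // iter_face_length.
by rewrite /face_walk along_edgeK across_cornerK.
Qed.

Lemma vtx1 x : vtx x 1 = x.1.2. Proof. exact: walk_start. Qed.
Lemma vtx2 x : vtx x 2 = (walk x).1.2. Proof. by rewrite /vtx /= walk_start. Qed.

Lemma face_length_gt2 x : is_flag e x -> (2 < len x)%N.
Proof.
move=> ex; have := vtx_length x 0; have := vtx_edge 0 ex; have := vtx_neq2 0 ex.
have := fingraph.order_gt0 walk x; rewrite -/(len x).
case: (len x) => [|[|[|n]]] //= _ n2 e1 eq0.
  by move/e_neq: e1; rewrite eq0 eqxx.
by rewrite eq0 eqxx in n2.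
Qed.

Lemma vtx_closed x k : len x = k ->
  (vtx x k = vtx x 0) * (vtx x k.+1 = vtx x 1).
Proof. by move=> <-; rewrite -(vtx_length x 0) -(vtx_length x 1). Qed.

Lemma face3_cycle3 x : is_flag e x -> len x = 3 -> has_cycle 3 e.
Proof.
move=> ex /vtx_closed [c0 _].
have := vtx_edge 0 ex; have := vtx_edge 1 ex; have := vtx_edge 2 ex; rewrite c0.
by move=> e2 e1 e0; exact: cycle3 e0 e1 e2.
Qed.

Lemma face4_cycle4 x : is_flag e x -> len x = 4 -> has_cycle 4 e.
Proof.
move=> ex /vtx_closed [c0 c1].
have := vtx_edge 3 ex; rewrite c0 => e3.
exact: cycle4 (vtx_edge 0 ex) (vtx_edge 1 ex) (vtx_edge 2 ex) e3 (vtx_neq2 0 ex) (vtx_neq2 1 ex).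
Qed.

(** Vertices one or two steps apart on the walk always differ, which leaves the three opposite
    pairs. *)
Lemma face6_cycle6 x : is_flag e x -> len x = 6 ->
    [&& vtx x 0 != vtx x 3, vtx x 1 != vtx x 4 & vtx x 2 != vtx x 5] ->
  has_cycle 6 e.
Proof.
move=> ex /vtx_closed [c0 c1]; have := vtx_edge 5 ex; rewrite c0 => e5.
apply: cycle6 (vtx_edge 0 ex) (vtx_edge 1 ex) (vtx_edge 2 ex) (vtx_edge 3 ex) (vtx_edge 4 ex) e5 _.
have := vtx_neq2 4 ex; have := vtx_neq2 5 ex; rewrite c0 c1 => n5 n4.
by rewrite !vtx_neq2 //= eq_sym n4 eq_sym n5.
Qed.

Lemma vtx_flip0 x : vtx (flip x) 0 = vtx x 0. Proof. by []. Qed.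
Lemma vtx_flip1 x : vtx (flip x) 1 = vtx x 1. Proof. by rewrite !vtx1. Qed.

Lemma vtx_flip2_neq x : is_flag e x -> vtx (flip x) 2 != vtx x 2.
Proof. by move=> ex; rewrite !vtx2 walk_flip_neq. Qed.

Lemma vtx_flip_last_neq x k l : is_flag e x -> len x = k.+1 -> len (flip x) = l.+1 ->
  vtx (flip x) l != vtx x k.
Proof.
move=> ex lx lx'; have := vtx_last x; have := vtx_last (flip x).
by rewrite lx lx' /= => -> ->; exact: across_flip_neq.
Qed.

Section NoTriangle.

Hypotheses (no3 : ~ has_cycle 3 e) (no6 : ~ has_cycle 6 e).

Lemma face_length_neq3 x : is_flag e x -> len x != 3.
Proof. by move=> ex; apply/eqP => /(face3_cycle3 ex). Qed.

(** If opposite vertices coincided, half of the face would be a triangle. *)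
Lemma face_length_neq6 x : is_flag e x -> len x != 6.
Proof.
move=> ex; apply/eqP => lx; apply: no6; apply: (face6_cycle6 ex lx).
have no_return i : vtx x i != vtx x (i + 3).
  apply/eqP => vi; apply: no3.
  have := vtx_edge i.+2 ex; rewrite addn3 in vi; rewrite -vi.
  exact: cycle3 (vtx_edge i ex) (vtx_edge i.+1 ex).
by rewrite (no_return 0) (no_return 1) (no_return 2).
Qed.

(** Faces v0 v1 v2 v3 and v0 v1 u2 u3 have outer boundary v0 v3 v2 v1 u2 u3. It is a 6-cycle: v2 =
    u3 or v3 = u2 would give a triangle, and v2 = u2 or v3 = u3 is excluded by the minimum
    degree. *)
Lemma face4_not_adjacent x : is_flag e x -> len x = 4 -> len (flip x) != 4.
Proof.
move=> ex lx; apply/eqP => lx'; have ex' : is_flag e (flip x) by [].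
have [c0 _] := vtx_closed lx; have [c0' _] := vtx_closed lx'.
have := vtx_edge 3 ex; have := vtx_edge 2 ex; have := vtx_edge 1 ex.
have := vtx_edge 3 ex'; have := vtx_edge 2 ex'; have := vtx_edge 1 ex'.
have := vtx_edge 0 ex; have := vtx_flip2_neq ex.
have := vtx_flip_last_neq ex lx lx'.
have := vtx_neq2 0 ex; have := vtx_neq2 1 ex.
have := vtx_neq2 0 ex'; have := vtx_neq2 1 ex'.
rewrite c0 c0' vtx_flip0 vtx_flip1.
move: (vtx x 0) (vtx x 1) (vtx x 2) (vtx x 3) (vtx (flip x) 2) (vtx (flip x) 3).
move=> v0 v1 v2 v3 u2 u3 n13' n02' n13 n02 n33 n22 e01 e12' e23' e30' e12 e23 e30.
have n32 : v3 != u2.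
  by apply/eqP => eq32; apply: no3; rewrite eq32 in e30; exact: cycle3 e01 e12' e30.
have n23 : v2 != u3.
  by apply/eqP => eq23; apply: no3; rewrite eq23 in e12; exact: cycle3 e01 e12 e30'.
apply: no6; apply: (@cycle6 v0 v3 v2 v1 u2 u3) => //; rewrite 1?[e _ _]e_sym //.
  by rewrite n02 n02' n13' [v3 == v1]eq_sym n13 [v3 == _]eq_sym n33 [v2 == _]eq_sym n22.
by rewrite n32 n23 e_neq.
Qed.

End NoTriangle.

Section NoFourCycle.

Hypotheses (no4 : ~ has_cycle 4 e) (no6 : ~ has_cycle 6 e).

Lemma face_length_neq4 x : is_flag e x -> len x != 4.
Proof. by move=> ex; apply/eqP => /(face4_cycle4 ex). Qed.

Lemma common_nbr_uniq a b c d :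
  a != b -> e a c -> e b c -> e a d -> e b d -> c = d.
Proof.
move=> nab ac bc ad bd; apply/eqP; apply: contraT => ncd; case: no4.
by apply: (@cycle4 a c b d) => //; rewrite e_sym.
Qed.

Lemma face3_apex x : is_flag e x -> len x = 3 ->
  e (vtx x 0) (vtx x 2) && e (vtx x 1) (vtx x 2).
Proof.
move=> ex /vtx_closed[c0 _]; rewrite (vtx_edge 1 ex) andbT e_sym.
by have := vtx_edge 2 ex; rewrite c0.
Qed.

(** Without 4-cycles the apex z is the only common neighbour of v0 and v1. Length 3 would give a
    second one; for length 5, replacing v0 v1 by the path through z gives a 6-cycle; a face of
    length 6 is a 6-cycle unless opposite vertices coincide, which again gives a second common
    neighbour. *)
Lemma face3_neighbour x : is_flag e x -> len x = 3 -> (6 < len (flip x))%N.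
Proof.
move=> ex lx; have ex' : is_flag e (flip x) by [].
have /andP[a02 a12] := face3_apex ex lx.
have e01 := vtx_edge 0 ex; have n01 := e_neq e01.
set z := vtx x 2 in a02 a12.
have apex (y : T) : e (vtx x 0) y -> e (vtx x 1) y -> y = z.
  by move=> e0y e1y; apply: common_nbr_uniq n01 e0y e1y a02 a12.
have nz2 : vtx (flip x) 2 != z by exact: vtx_flip2_neq.
have nzl l : len (flip x) = l.+1 -> vtx (flip x) l != z.
  by move=> lx'; exact: vtx_flip_last_neq lx lx'.
have := face_length_gt2 ex'; have := face_length_neq4 ex'.
case lx' : (len (flip x)) => [|[|[|[|[|[|[|n]]]]]]] //= _ _.
- have /andP[b02 b12] := face3_apex ex' lx'.
  by move: b02 b12; rewrite vtx_flip0 vtx_flip1 => b02 b12; case/eqP: nz2; exact: apex.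
- have [c0 c1] := vtx_closed lx'; have {}nzl := nzl _ lx'.
  have := vtx_edge 4 ex'; have := vtx_edge 3 ex'; have := vtx_edge 2 ex'.
  have := vtx_edge 1 ex'; have := vtx_neq2 4 ex'; have := vtx_neq2 3 ex'.
  have := vtx_neq2 2 ex'; have := vtx_neq2 1 ex'; have := vtx_neq2 0 ex'.
  rewrite c0 c1 vtx_flip0 vtx_flip1; move: z (vtx x 0) (vtx x 1) a02 a12 e01 n01 apex nz2 nzl.
  move: (vtx (flip x) 2) (vtx (flip x) 3) (vtx (flip x) 4) => u2 u3 u4 z v0 v1.
  move=> e0z e1z e01 n01 apex nz2 nz4 n02 n13 n24 n30 n41 e12 e23 e34 e40.
  have nz3 : u3 != z.
    apply/eqP => u3z; apply: no4; rewrite -u3z in e0z.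
    by apply: (@cycle4 v0 v1 u2 u3) => //; rewrite e_sym.
  case: no6; apply: (@cycle6 v0 z v1 u2 u3 u4) => //; first by rewrite e_sym.
    by rewrite n01 n13 n24 [z == _]eq_sym nz2 [v0 == _]eq_sym n30 [z == _]eq_sym nz4.
  by rewrite n02 [v1 == _]eq_sym n41 [z == _]eq_sym nz3.
- have [c0 c1] := vtx_closed lx'; have {}nzl := nzl _ lx'.
  have := vtx_edge 5 ex'; have := vtx_edge 4 ex'; have := vtx_edge 3 ex'.
  have := vtx_edge 2 ex'; have := vtx_edge 1 ex'; rewrite c0 vtx_flip0 vtx_flip1 => e12 e23 e34 e45 e50.
  case: no6; apply: (face6_cycle6 ex' lx'); apply/and3P; rewrite vtx_flip0 vtx_flip1.
  split; apply/eqP => eqv.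
  + by rewrite -eqv in e23; case/eqP: nz2; apply: apex => //; rewrite e_sym.
  + by rewrite -eqv in e45; case/eqP: nzl; apply: apex => //; rewrite e_sym.
  + by rewrite -eqv in e50; case/eqP: nz2; apply: apex => //; rewrite e_sym.
Qed.

End NoFourCycle.

End FaceCycles.

(** * Discharging *)

Section Discharging.

Variables (T : finType) (e : rel T) (M : embedding_scheme e).
Hypothesis e_simple : simple_graph e.
Hypothesis min_degree : forall v w, e v w -> 2 < degree e v.
Hypothesis cubic_indep : forall v w, e v w -> degree e v = 3 -> 3 < degree e w.
Implicit Types (v w : T) (x y z : flag T).

Local Notation alpha := (along_edge M).
Local Notation beta := (across_corner M).
Local Notation walk := (face_walk M).
Local Notation len := (face_length M).
Local Notation deg x := (degree e x.1.1).
Local Open Scope ring_scope.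

Hypothesis curvature : \sum_(x : flag T | is_flag e x)
  (1 - 2 / (deg x)%:R - 2 / (len x)%:R) <= 0 :> rat.

Lemma sum_flags_inj (h : flag T -> flag T) (F : flag T -> rat) :
    injective h -> (forall x, is_flag e (h x) = is_flag e x) ->
  \sum_(x | is_flag e x) F (h x) = \sum_(x | is_flag e x) F x.
Proof.
by move=> injh eh; rewrite [RHS](reindex_inj injh); apply: eq_bigl => x.
Qed.

(** Windows of fixed size along the orbits of [h] replace averages over orbits of varying size. *)
Lemma sum_flags_iter (h : flag T -> flag T) (F : flag T -> rat) n :
    injective h -> (forall x, is_flag e (h x) = is_flag e x) ->
  \sum_(x | is_flag e x) \sum_(i < n) F (iter i h x) =
  n%:R * \sum_(x | is_flag e x) F x.
Proof.
move=> injh eh; rewrite exchange_big /= (eq_bigr (fun=> \sum_(x | is_flag e x) F x)).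
  by rewrite sumr_const card_ord mulr_natl.
move=> i _; apply: sum_flags_inj => [|x]; first by elim: (val i) => //= j IHj x y /injh/IHj.
by elim: (val i) => //= j <-.
Qed.

Lemma sum_flags_eq0 (F : flag T -> rat) :
    (forall x, is_flag e x -> 0 <= F x) -> \sum_(x | is_flag e x) F x <= 0 ->
  forall x, is_flag e x -> F x = 0.
Proof.
move=> F0 sF; apply: psumr_eq0P => //; apply/eqP; rewrite eq_le sF.
exact: sumr_ge0.
Qed.

Definition spin x : flag T := (x.1.1, rotation M x.1.1 x.1.2, x.2).

Lemma spin_inj : injective spin.
Proof. by case=> [[v w] s] [[v' w'] s'] [/= <- /perm_inj <- <-]. Qed.

Lemma is_flag_spin x : is_flag e (spin x) = is_flag e x.
Proof. by rewrite /is_flag /= rotation_nbr. Qed.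

Lemma spin3 x : is_flag e x -> deg x = 3%N -> spin (spin (spin x)) = x.
Proof.
case: x => [[v w] s]; rewrite /is_flag /spin /= => evw d3.
have := iter_porbit (rotation M v) w.
by rewrite rotation_cyclic // -/(degree e v) d3 /= => ->.
Qed.

Lemma face_length_spin x : if x.2 then len (flip (spin x)) = len x
  else len (spin x) = len (flip x).
Proof.
case: x => [[v w] []] /=; first by rewrite -[RHS]face_length_across.
by rewrite -[RHS]face_length_across.
Qed.

Lemma deg_walk x : is_flag e x -> deg x = 3%N -> (3 < deg (walk x))%N.
Proof. by rewrite walk_start; exact: cubic_indep. Qed.

Lemma deg_along x : is_flag e x -> deg x = 3%N -> (3 < deg (alpha x))%N.
Proof. by case: x => [[v w] s]; exact: cubic_indep. Qed.

Lemma inv_natr_le (m n : nat) : (m < n)%N -> n%:R^-1 <= m.+1%:R^-1 :> rat.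
Proof. by move=> mn; rewrite lef_pV2 ?ler_nat // posrE ltr0n // (leq_ltn_trans _ mn). Qed.

Let deg_ge3 x : is_flag e x -> (2 < deg x)%N.
Proof. exact: min_degree. Qed.

(** Once the degree term is averaged over the two ends of each edge, every term is at least 1 - 1/3
    - 1/4 - 2/5 = 1/60, since the ends are not both cubic and faces have length at least 5. *)
Lemma girth5_contradiction x :
  is_flag e x -> ~ has_cycle 3 e -> ~ has_cycle 4 e -> False.
Proof.
move=> ex no3 no4.
pose F y : rat := 1 - (deg y)%:R^-1 - (deg (alpha y))%:R^-1 - 2 / (len y)%:R.
have Fpos y : is_flag e y -> 0 < F y.
  move=> ey; have eay : is_flag e (alpha y) by rewrite is_flag_along.
  have l5 : (5 <= len y)%N.
    have := face_length_gt2 M e_simple min_degree ey.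
    have := face_length_neq4 M e_simple min_degree no4 ey.
    have := face_length_neq3 M e_simple no3 ey.
    by case: (len y) => [|[|[|[|[|n]]]]].
  have := inv_natr_le l5; have := inv_natr_le (deg_ge3 ey).
  have := inv_natr_le (deg_ge3 eay); rewrite /F.
  have := deg_ge3 ey; rewrite leq_eqVlt => /predU1P[/esym d3|d4].
    by have := inv_natr_le (deg_along ey d3); lra.
  by have := inv_natr_le d4; lra.
have /sum_flags_eq0/(_ _ x ex) Fx : forall y, is_flag e y -> 0 <= F y by move=> y /Fpos/ltW.
have := Fpos x ex; rewrite Fx ?ltxx //; move: curvature.
rewrite /F !big_split /= !sumrN.
rewrite (sum_flags_inj (fun y => (deg y)%:R^-1) (inv_inj (along_edgeK M))) => [|y]; last first.
  exact: is_flag_along.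
by rewrite -[X in _ - X - _]mulr_sumr; lra.
Qed.

(** Each of the three corners at the cubic vertex is counted twice. The extreme face lengths are 3,
    7, 7, with 1/3 + 2/7 = 13/21; without a 3-face the bound is 3/5. *)
Lemma sum_len_spin x : is_flag e x -> deg x = 3%N -> ~ has_cycle 4 e -> ~ has_cycle 6 e ->
  \sum_(i < 3) ((len (iter i spin x))%:R^-1 + (len (flip (iter i spin x)))%:R^-1)
    <= 26 / 21 :> rat.
Proof.
move=> ex d3 no4 no6; rewrite !big_ord_recr big_ord0 /= add0r.
have adj y : is_flag e y -> [/\ (2 < len y)%N, len y != 4 & len y = 3%N -> (6 < len (flip y))%N].
  move=> ey; split; first exact: face_length_gt2.
    exact: (face_length_neq4 M e_simple min_degree no4).
  exact: face3_neighbour.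
have e1 : is_flag e (spin x) by rewrite is_flag_spin.
have e2 : is_flag e (spin (spin x)) by rewrite is_flag_spin.
have [a0 b0 c0] := adj _ ex; have [a1 b1 c1] := adj _ e1; have [a2 b2 c2] := adj _ e2.
have [_ _ c0'] := adj (flip x) ex; have [_ _ c1'] := adj (flip (spin x)) e1.
have [_ _ c2'] := adj (flip (spin (spin x))) e2; rewrite !flipK in c0' c1' c2'.
have key (a b c : nat) : (2 < a)%N -> (2 < b)%N -> (2 < c)%N ->
    a != 4 -> b != 4 -> c != 4 ->
    (a = 3 -> 6 < b /\ 6 < c)%N -> (b = 3 -> 6 < c /\ 6 < a)%N -> (c = 3 -> 6 < a /\ 6 < b)%N ->
    a%:R^-1 + b%:R^-1 + c%:R^-1 <= 13 / 21 :> rat.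
  move=> la lb lc na nb nc a3 b3 c3.
  have := inv_natr_le la; have := inv_natr_le lb; have := inv_natr_le lc.
  have [/a3[/inv_natr_le ? /inv_natr_le ?]|na3] := eqVneq a 3%N; first by lra.
  have [/b3[/inv_natr_le ? /inv_natr_le ?]|nb3] := eqVneq b 3%N; first by lra.
  have [/c3[/inv_natr_le ? /inv_natr_le ?]|nc3] := eqVneq c 3%N; first by lra.
  have ge5 (n : nat) : (2 < n)%N -> n != 4 -> n != 3 -> n%:R^-1 <= 5^-1 :> rat.
    by move=> n2 n4 n3; apply: (@inv_natr_le 4); lia.
  by have := ge5 a la na na3; have := ge5 b lb nb nb3; have := ge5 c lc nc nc3; lra.
have {}key := key _ _ _ a0 a1 a2 b0 b1 b2.
have F1 := face_length_spin x; have F2 := face_length_spin (spin x).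
have F0 := face_length_spin (spin (spin x)); rewrite (spin3 ex d3) in F0.
move: F0 F2 F1; rewrite -[(spin (spin x)).2]/(x.2) -[(spin x).2]/(x.2).
have half (a b c a' b' c' : rat) : a + b + c <= 13 / 21 ->
    a' + b' + c' = a + b + c -> a + a' + (b + b') + (c + c') <= 26 / 21 by lra.
case: (x.2) => F0 F2 F1; move: key c0 c0' c1 c1' c2 c2'.
  rewrite F0 F1 F2 => key c0 c0' c1 c1' c2 c2'.
  by apply: half; [apply: key => h; split; auto | ring].
rewrite -F0 -F1 -F2 => key c0 c0' c1 c1' c2 c2'.
by apply: half; [apply: key => h; split; auto | ring].
Qed.

(** The curvature averaged over the four flags of the edge. *)
Definition edge_charge x : rat :=
  1 - (deg x)%:R^-1 - (deg (alpha x))%:R^-1 - (len x)%:R^-1 - (len (flip x))%:R^-1.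

Lemma sum_edge_charge :
  \sum_(x | is_flag e x) edge_charge x <= 0.
Proof.
move: curvature; rewrite /edge_charge !big_split /= !sumrN.
rewrite (sum_flags_inj (fun y => (deg y)%:R^-1) (inv_inj (along_edgeK M))) => [|y]; last first.
  exact: is_flag_along.
rewrite (sum_flags_inj (fun y => (len y)%:R^-1) (inv_inj (@flipK T))) //.
by rewrite -![X in _ - X <= 0 -> _]mulr_sumr -[X in _ - X - _ <= 0 -> _]mulr_sumr; lra.
Qed.

(** An edge without cubic end has positive charge, as 1/3 + 1/7 and 2/5 are below 1/2. At a cubic
    vertex the three edges have total charge at least 3 (1 - 1/3 - 1/4) - 26/21 = 1/84. *)
Lemma no_cycles46_contradiction x :
  is_flag e x -> ~ has_cycle 4 e -> ~ has_cycle 6 e -> False.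
Proof.
move=> ex no4 no6.
have charge_along y : edge_charge (alpha y) = edge_charge y.
  rewrite /edge_charge along_edgeK -along_flip !face_length_along; ring.
(* The charge of an edge with a cubic end is moved to the flags at that end. *)
pose B y : rat := edge_charge y + (if deg y == 3%N then edge_charge y else 0)
  - (if deg (alpha y) == 3%N then edge_charge (alpha y) else 0).
have sumB : \sum_(y | is_flag e y) B y <= 0.
  rewrite /B big_split big_split /= sumrN.
  rewrite (sum_flags_inj (fun y => if deg y == 3%N then edge_charge y else 0) (inv_inj (along_edgeK M))) => [|y]; last first.
    exact: is_flag_along.
  by rewrite addrK; exact: sum_edge_charge.
have B3 y : is_flag e y -> deg y = 3%N -> B y = 2 * edge_charge y.
  move=> ey d3; rewrite /B d3 /=; have := deg_along ey d3.
  by case: eqP => [->//|_ _]; rewrite subr0; ring.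
have charge_pos y : is_flag e y -> (3 < deg y)%N -> (3 < deg (alpha y))%N -> 0 < edge_charge y.
  move=> ey /inv_natr_le d4 /inv_natr_le d4'; have ey' : is_flag e (flip y) by [].
  have := inv_natr_le (face_length_gt2 M e_simple min_degree ey).
  have := inv_natr_le (face_length_gt2 M e_simple min_degree ey').
  rewrite /edge_charge.
  have [l3|nl3] := eqVneq (len y) 3%N.
    have := inv_natr_le (face3_neighbour e_simple min_degree no4 no6 ey l3); lra.
  have [l3'|nl3'] := eqVneq (len (flip y)) 3%N.
    have := inv_natr_le (face3_neighbour e_simple min_degree no4 no6 ey' l3').
    by rewrite flipK; lra.
  have ge5 z : is_flag e z -> len z != 3%N -> (len z)%:R^-1 <= 5^-1 :> rat.
    move=> ez n3; apply: (@inv_natr_le 4).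
    have := face_length_gt2 M e_simple min_degree ez.
    by have := face_length_neq4 M e_simple min_degree no4 ez; lia.
  by have := ge5 y ey nl3; have := ge5 _ ey' nl3'; lra.
have B4 y : is_flag e y -> (3 < deg y)%N ->
    0 <= B y /\ ((3 < deg (alpha y))%N -> 0 < B y).
  move=> ey d4; have ny : (deg y == 3%N) = false by lia.
  rewrite /B ny charge_along addr0; case: ifPn => [/eqP -> |nd3].
    by rewrite subrr lexx.
  have d4' : (3 < deg (alpha y))%N.
    by have := deg_ge3 (_ : is_flag e (alpha y)); rewrite is_flag_along // => /(_ ey); lia.
  by rewrite subr0; split=> [|_]; [apply: ltW|]; exact: charge_pos.
(* A window of three turns covers all half-edges at a cubic vertex; at other vertices it only
   collects nonnegative terms. *)
pose G y := \sum_(i < 3) B (iter i spin y).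
have flag_iter i y : is_flag e y -> is_flag e (iter i spin y).
  by move=> ey; elim: i => //= i IHi; rewrite is_flag_spin.
have deg_iter i y : deg (iter i spin y) = deg y by elim: i.
have G3 y : is_flag e y -> deg y = 3%N -> 0 < G y.
  move=> ey d3; rewrite /G (eq_bigr (fun i : 'I_3 => 2 * edge_charge (iter i spin y))); last first.
    by move=> i _; rewrite B3 ?deg_iter ?flag_iter.
  rewrite -mulr_sumr mulr_gt0 //.
  have := sum_len_spin ey d3 no4 no6; rewrite -subr_ge0 => le_len.
  suff : \sum_(i < 3) (5 / 12 : rat) <=
      \sum_(i < 3) (edge_charge (iter i spin y) +
        ((len (iter i spin y))%:R^-1 + (len (flip (iter i spin y)))%:R^-1)).
    by rewrite big_split /= sumr_const card_ord -mulr_natr; lra.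
  apply: ler_sum => i _; set z := iter i spin y.
  have ez : is_flag e z by exact: flag_iter.
  have dz : deg z = 3%N by rewrite /z deg_iter.
  by have := inv_natr_le (deg_along ez dz); rewrite /edge_charge dz; lra.
have G4 y : is_flag e y -> (3 < deg y)%N -> 0 <= G y /\ ((3 < deg (alpha y))%N -> 0 < G y).
  move=> ey d4; have Bi i : 0 <= B (iter i spin y).
    by case: (B4 (iter i spin y)); rewrite ?deg_iter ?flag_iter.
  split=> [|d4']; first by apply: sumr_ge0 => i _.
  rewrite /G big_ord_recl /= ltr_pwDl //; last by apply: sumr_ge0 => i _; exact: (Bi (bump 0 i)).
  by case: (B4 y ey d4) => _; apply.
have sumG : \sum_(y | is_flag e y) G y <= 0.
  rewrite (sum_flags_iter _ _ spin_inj is_flag_spin); move: sumB; lra.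
have /sum_flags_eq0/(_ sumG) G0 : forall y, is_flag e y -> 0 <= G y.
  move=> y ey; have := deg_ge3 ey; rewrite leq_eqVlt => /predU1P[/esym d3|d4].
    exact/ltW/G3.
  by case: (G4 y ey d4).
have eax : is_flag e (alpha x) by rewrite is_flag_along.
have := deg_ge3 ex; rewrite leq_eqVlt => /predU1P[/esym d3|d4].
  by have := G3 x ex d3; rewrite G0 ?ltxx.
have := deg_ge3 eax; rewrite leq_eqVlt => /predU1P[/esym d3'|d4'].
  by have := G3 _ eax d3'; rewrite G0 ?ltxx.
by case: (G4 x ex d4) => _ /(_ d4'); rewrite G0 ?ltxx.
Qed.

(** * Graphs without 3-cycles and 6-cycles *)

Section NoCycles36.

Hypotheses (no3 : ~ has_cycle 3 e) (no6 : ~ has_cycle 6 e).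

Let long y : bool := (4 < len y)%N.
Let cubic y : bool := deg y == 3%N.
(* Each face of length at least 5 sends 1/2 to each of its cubic corners, that*)
(* is, 1/4 to each of the two flags there.                                    *)
Let sent y : rat := if cubic y && long y then 4^-1 else 0.
Let vertex_charge y : rat := 2^-1 - 2 / (deg y)%:R + sent y.
Let face_charge y : rat := 2^-1 - 2 / (len y)%:R - sent y.

(** Among five consecutive vertices at most three are cubic, and at most two if they close up into a
    5-face. The sum is at least 5 (1/2 - 2/7) - 3/4 > 0 from length 7 on, 1/2 - k/4 with k <= 2 for
    length 5, and 0 for length 4. *)
Let face_charge_ge0 y : is_flag e y ->
  0 <= \sum_(i < 5) face_charge (iter i walk y) /\
  (\sum_(i < 5) face_charge (iter i walk y) = 0 ->
     (len y <= 5)%N /\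
     (len y = 5%N -> (\sum_(i < 5) cubic (iter i walk y) = 2)%N)).
Proof.
move=> ey.
have len_iter i : len (iter i walk y) = len y.
  by elim: i => //= i IHi; rewrite face_length_walk.
pose c i := cubic (iter i walk y).
have step i : ~~ (c i && c i.+1).
  have ez : is_flag e (iter i walk y) by rewrite is_flag_iter_walk.
  apply/negP => /andP[/eqP d3 /eqP d3'].
  by have := deg_walk ez d3; rewrite -iterS d3'.
rewrite -[(\sum_(i < 5) cubic _)%N]/(\sum_(i < 5) c i)%N; set k := (\sum_(i < 5) c i)%N.
have sumE : \sum_(i < 5) face_charge (iter i walk y) =
    5 * (2^-1 - 2 / (len y)%:R) - (k * (4 < len y))%:R / 4.
  rewrite (eq_bigr (fun i : 'I_5 => 2^-1 - 2 / (len y)%:R - (c i * (4 < len y))%:R / 4)).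
    by rewrite sumrB sumr_const card_ord [5 * _]mulr_natl -mulr_suml -natr_sum -big_distrl.
  move=> i _; rewrite /face_charge /sent /long len_iter -/(c i).
  by case: (c i) (4 < len y)%N => -[]; rewrite ?mul1r ?mul0r.
have c5 : len y = 5%N -> ~~ (c 4 && c 0%N).
  move=> l5; have := step 4; suff -> : c 5 = c 0%N by [].
  by rewrite /c (_ : iter 5 walk y = y) // -[RHS](iter_face_length M y) l5.
have k3 : (k <= 3)%N.
  rewrite /k !big_ord_recr big_ord0 /=.
  move: (step 0%N) (step 1%N) (step 2) (step 3).
  by case: (c 0%N); case: (c 1%N); case: (c 2); case: (c 3); case: (c 4).
have k2 : len y = 5%N -> (k <= 2)%N.
  move=> /c5; rewrite /k !big_ord_recr big_ord0 /=.
  move: (step 0%N) (step 1%N) (step 2) (step 3).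
  by case: (c 0%N); case: (c 1%N); case: (c 2); case: (c 3); case: (c 4).
have := face_length_gt2 M e_simple min_degree ey.
have := face_length_neq3 M e_simple no3 ey.
have := face_length_neq6 M e_simple min_degree no3 no6 ey.
rewrite sumE {sumE c5 step}; clearbody k; move: (len y) k2 => l k2 n6 n3 l3.
have [l7|] := leqP 7 l.
  have -> : (4 < l)%N by exact: leq_trans l7.
  have := inv_natr_le l7; move: k3; rewrite muln1 -(ler_nat rat).
  move=> k3r l7r; suff pos : 0 < 5 * (2^-1 - 2 / l%:R) - k%:R / 4 :> rat.
    by split=> [|eq0]; [exact: ltW | rewrite eq0 ltxx in pos].
  by lra.
move=> l7; have [eq_l|eq_l] : l = 4 \/ l = 5 by lia.
  by rewrite eq_l ltnn muln0; split=> [|_]; [lra | split].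
move: (k2 eq_l); rewrite eq_l ltnSn muln1 -(ler_nat rat) => k2'.
split=> [|h]; first by lra.
have -> : k = 2 by apply/eqP; rewrite -(eqr_nat rat); apply/eqP; lra.
by clear h; split.
Qed.

Let long_spin y : is_flag e y -> long y || long (spin y).
Proof.
have longE z : is_flag e z -> ~~ long z -> len z = 4.
  move=> ez; have := face_length_gt2 M e_simple min_degree ez.
  by have := face_length_neq3 M e_simple no3 ez; rewrite /long; lia.
move=> ey; have eys : is_flag e (spin y) by rewrite is_flag_spin.
apply: contraT; rewrite negb_or => /andP[/(longE _ ey) l4 /(longE _ eys) l4'].
have := face4_not_adjacent e_simple min_degree no3 no6 ey l4.
have := face4_not_adjacent e_simple min_degree no3 no6 eys l4'.
have := face_length_spin y; case: (y.2) => [->|<-]; first by rewrite l4 eqxx.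
by rewrite l4' eqxx.
Qed.

(** From degree 4 on, 1/2 - 2/d >= 0 with equality only at 4. A cubic vertex lacks 3 (2/3 - 1/2) =
    1/2, and by [long_spin] at least two of the three flags receive 1/4. *)
Let vertex_charge_ge0 y : is_flag e y ->
  0 <= \sum_(i < 3) vertex_charge (iter i spin y) /\
  (\sum_(i < 3) vertex_charge (iter i spin y) = 0 -> (deg y <= 4)%N).
Proof.
move=> ey; have deg_iter i : deg (iter i spin y) = deg y by elim: i.
have sent0 z : 0 <= sent z by rewrite /sent; case: ifP.
have := deg_ge3 ey; rewrite leq_eqVlt => /predU1P[/esym d3|d4]; last first.
  have chargeE i : 2^-1 - 2 / (deg y)%:R <= vertex_charge (iter i spin y).
    by rewrite /vertex_charge deg_iter lerDl.
  rewrite !big_ord_recr !big_ord0 /= add0r.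
  have := inv_natr_le d4; have := chargeE 0%N; have := chargeE 1%N; have := chargeE 2 => /=.
  move=> g2 g1 g0 le4; split; first by lra.
  by rewrite leqNgt => g_0; apply/negP => /inv_natr_le le5; lra.
have ey1 : is_flag e (spin y) by rewrite is_flag_spin.
have ey2 : is_flag e (spin (spin y)) by rewrite is_flag_spin.
have k2 : (2 <= long y + long (spin y) + long (spin (spin y)))%N.
  have := long_spin ey; have := long_spin ey1; have := long_spin ey2; rewrite (spin3 ey d3).
  by case: (long y); case: (long (spin y)); case: (long (spin (spin y))).
move: k2; rewrite -(ler_nat rat) !natrD => k2.
have chargeE z : deg z = 3%N -> vertex_charge z = 2^-1 - 2 / 3 + (long z)%:R / 4.
  by move=> dz; rewrite /vertex_charge /sent /cubic dz eqxx; case: (long z); rewrite ?mul1r ?mul0r.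
have -> : \sum_(i < 3) vertex_charge (iter i spin y) =
    vertex_charge y + vertex_charge (spin y) + vertex_charge (spin (spin y)).
  by rewrite !big_ord_recr big_ord0 /= add0r.
rewrite (chargeE y d3) (chargeE (spin y) d3) (chargeE (spin (spin y)) d3).
by split=> [|_]; [lra | rewrite d3].
Qed.

(** The windowed charges are nonnegative with total at most 0, so all vanish and the equality cases
    apply. *)
Lemma no_cycles36_charge y : is_flag e y ->
  [/\ (deg y <= 4)%N, (len y <= 5)%N
    & len y = 5%N -> (\sum_(i < 5) cubic (iter i walk y) = 2)%N].
Proof.
pose G z := 3^-1 * (\sum_(i < 3) vertex_charge (iter i spin z)) +
            5^-1 * (\sum_(i < 5) face_charge (iter i walk z)).
have sumG : \sum_(z | is_flag e z) G z <= 0.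
  rewrite big_split /= -!mulr_sumr (sum_flags_iter _ _ spin_inj is_flag_spin).
  rewrite (sum_flags_iter _ _ (@face_walk_inj _ _ M)) => [|z]; last exact: is_flag_walk.
  rewrite !mulrA !mulVf ?pnatr_eq0 // !mul1r -big_split /=.
  rewrite (eq_bigr (fun z => 1 - 2 / (deg z)%:R - 2 / (len z)%:R)) // => z _.
  by rewrite /vertex_charge /face_charge; lra.
move=> ey.
have [v0 vE] := vertex_charge_ge0 ey; have [f0 fE] := face_charge_ge0 ey.
have := sum_flags_eq0 _ sumG ey; rewrite /G => Gy.
have {}Gy : 3^-1 * (\sum_(i < 3) vertex_charge (iter i spin y)) +
            5^-1 * (\sum_(i < 5) face_charge (iter i walk y)) = 0.
  apply: Gy => z ez; case: (vertex_charge_ge0 ez) => vz _.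
  by case: (face_charge_ge0 ez) => fz _; rewrite addr_ge0 // mulr_ge0.
have [|l5 c2] := fE; first by lra.
by split=> //; apply: vE; lra.
Qed.

(** The other four vertices of the face form a path with two nonadjacent cubic vertices, one of
    which must be an end of the path. *)
Let face5_cubic_nbr y : is_flag e y -> deg y = 4 -> len y = 5%N ->
  (degree e y.1.2 == 3%N) || (degree e (beta y).1.2 == 3%N).
Proof.
move=> ey d4 l5; have [_ _ /(_ l5)] := no_cycles36_charge ey.
rewrite -(walk_start M) -vtx_last l5 /vtx -[_ == _]/(cubic (walk y)).
rewrite -[degree _ _ == _]/(cubic (iter 4 walk y)) !big_ord_recr big_ord0 /=.
have step i : ~~ (cubic (iter i walk y) && cubic (iter i.+1 walk y)).
  have ez : is_flag e (iter i walk y) by rewrite is_flag_iter_walk.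
  apply/negP => /andP[/eqP d3 /eqP d3'].
  by have := deg_walk ez d3; rewrite -iterS d3'.
have -> : cubic y = false by rewrite /cubic d4.
have := step 1%N; have := step 2; have := step 3; rewrite /=.
by case: (cubic (walk y)); case: (cubic (walk (walk y)));
  case: (cubic (walk (walk (walk y)))); case: (cubic (walk _)).
Qed.

(** Of two consecutive faces at [v] one has length 5 and provides a cubic neighbour, so any three
    consecutive neighbours include a cubic one; four neighbours in cyclic order then include two. *)
Lemma no_cycles36_cubic_nbrs v w : e v w -> degree e v = 4 ->
  (1 < #|[set u | e v u & degree e u == 3%N]|)%N.
Proof.
move=> evw d4; pose r := rotation M v; pose c i := degree e (iter i r w) == 3%N.
pose y i : flag T := (v, iter i r w, true).
have ey i : is_flag e (y i).
  by rewrite /is_flag /=; elim: i => //= i IHi; rewrite rotation_nbr.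
have near i : [|| c i, c i.+1 | c i.+2].
  have side j : long (y j) -> c j || c j.+1.
    move=> l5; apply: (@face5_cubic_nbr (y j)) => //; apply/eqP; rewrite eqn_leq.
    by have [_ -> _] := no_cycles36_charge (ey j).
  have /orP[/side|/side] : long (y i) || long (y i.+1) := long_spin (ey i).
    by rewrite orbA => ->.
  by move=> h; rewrite h orbT.
have w4 : iter 4 r w = w.
  by have := iter_porbit r w; rewrite rotation_cyclic // -/(degree e v) d4.
have c4 : c 4 = c 0%N by rewrite /c w4.
have c5 : c 5 = c 1%N by rewrite /c [iter 5 r w]iterS w4.
have := rotation_uniq M evw; rewrite d4 -/r => Uw.
have count2 : (1 < count (fun u => degree e u == 3%N) (traject r w 4))%N.
  have := near 0%N; have := near 1%N; have := near 2; have := near 3; rewrite c5 c4 /=.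
  rewrite -[degree e w == _]/(c 0%N) -[degree e (r w) == _]/(c 1%N).
  rewrite -[degree e (r (r w)) == _]/(c 2) -[degree e (r (r (r w))) == _]/(c 3).
  by case: (c 0%N); case: (c 1%N); case: (c 2); case: (c 3).
apply: leq_trans count2 _; rewrite -size_filter -(card_uniqP (filter_uniq _ Uw)).
apply/subset_leq_card/subsetP => u; rewrite mem_filter inE => /andP[-> /trajectP[i _ ->]].
by rewrite andbT; have := ey i.
Qed.

End NoCycles36.

End Discharging.

(** * Induction on the vertex set *)

Section Main.

Variables (T : finType) (e : rel T).
Hypothesis e_simple : simple_graph e.
Hypothesis e_surface : embeds_nonneg_char e.
Hypothesis e_cycles : [\/ ~ has_cycle 3 e /\ ~ has_cycle 4 e,
                          ~ has_cycle 3 e /\ ~ has_cycle 6 e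
                        | ~ has_cycle 4 e /\ ~ has_cycle 6 e].

(** The graph induced on [S] is transported into the embedded graph as [f]; its degrees are those in
    [S] and its cycles come from [e], so the discharging applies to it. *)
Lemma irreducible_dec (S : {set T}) : S != set0 ->
    (forall v, v \in S -> 2 < #|nbr_in e S v|) ->
    (forall u v, u \in S -> v \in S -> e u v -> #|nbr_in e S u| <= 3 ->
       3 < #|nbr_in e S v|) ->
  decomposable_in e S set0.
Proof.
move=> /set0Pn[x0 x0S] min3 cubic.
have [U [eH [M [i [eH_simple eH_conn i_inj i_hom chi]]]]] := e_surface.
have [symE irrE] := e_simple.
pose f : rel U := [rel a b | [exists x, exists y,
  [&& x \in S, y \in S, e x y, i x == a & i y == b]]].
have fP a b : f a b -> exists x y, [/\ x \in S, y \in S, e x y, i x = a & i y = b].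
  by case/existsP=> x /existsP[y /and5P[xS yS exy /eqP ia /eqP ib]]; exists x, y.
have fE x y : f (i x) (i y) = [&& x \in S, y \in S & e x y].
  apply/idP/idP => [/fP[x' [y' [xS yS exy /i_inj <- /i_inj <-]]]|].
    by rewrite xS yS.
  case/and3P=> xS yS exy; apply/existsP; exists x; apply/existsP; exists y.
  by rewrite xS yS exy !eqxx.
have f_sym : symmetric f.
  suff sub a b : f a b -> f b a by move=> a b; apply/idP/idP; exact: sub.
  by case/fP=> x [y [xS yS exy <- <-]]; rewrite fE xS yS symE.
have f_sub : subrel f eH by move=> a b /fP[x [y [_ _ exy <- <-]]]; exact: i_hom.
have f_simple := sub_simple eH_simple f_sym f_sub.
have f_nbr x : x \in S -> nbr f (i x) = i @: nbr_in e S x.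
  move=> xS; apply/setP => b; rewrite inE; apply/idP/imsetP.
    case/fP=> x' [y [_ yS exy /i_inj eq_x <-]]; exists y => //.
    by rewrite inE yS -eq_x.
  by case=> y; rewrite inE => /andP[yS exy] ->; rewrite fE xS yS.
have f_deg x : x \in S -> degree f (i x) = #|nbr_in e S x|.
  by move=> xS; rewrite /degree f_nbr // card_imset.
have f_min a b : f a b -> 2 < degree f a.
  by case/fP=> x [y [xS _ _ <- _]]; rewrite f_deg ?min3.
have f_cubic a b : f a b -> degree f a = 3 -> 3 < degree f b.
  case/fP=> x [y [xS yS exy <- <-]]; rewrite !f_deg // => d3.
  by apply: (cubic x y); rewrite ?d3.
have [y0] : exists y, y \in nbr_in e S x0.
  by apply/card_gt0P; apply: leq_trans (min3 _ x0S).
rewrite inE => /andP[y0S exy0].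
have f0 : f (i x0) (i y0) by rewrite fE x0S y0S.
pose N := sub_scheme M f_sub.
have curv := curvature_le0 f_simple (darts_sub_scheme eH_simple f_sym f_sub eH_conn chi f0).
have f_cycle k : has_cycle k f -> has_cycle k e.
  (* All vertices of a cycle of [f] are in the image of [i], where [g] inverts [i]; the default [x0]
     does not occur there. *)
  case=> c [szc /andP[fc Uc]]; pose g a := odflt x0 [pick x | i x == a].
  have gK x : g (i x) = x.
    by rewrite /g; case: pickP => [y /eqP/i_inj //|/(_ x)]; rewrite eqxx.
  exists (map g c); split; first by rewrite size_map.
  apply/andP; split.
    rewrite cycle_map; apply: sub_cycle fc => a b /fP[x [y [_ _ exy <- <-]]].
    by rewrite /= !gK.
  rewrite map_inj_in_uniq // => a b ac bc.
  have /fP[x [_ [_ _ _ <- _]]] := next_cycle fc ac.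
  have /fP[y [_ [_ _ _ <- _]]] := next_cycle fc bc.
  by rewrite !gK => ->.
have flag0 : is_flag f (i x0, i y0, true) by [].
have nf k : ~ has_cycle k e -> ~ has_cycle k f by move=> nk /f_cycle.
case: e_cycles => -[/nf n1 /nf n2].
- by case: (girth5_contradiction f_simple f_min f_cubic curv flag0 n1 n2).
- have deg4 x : x \in S -> #|nbr_in e S x| <= 4.
    move=> xS; have [y] : exists y, y \in nbr_in e S x.
      by apply/card_gt0P; apply: leq_trans (min3 _ xS).
    rewrite inE => /andP[yS exy]; rewrite -f_deg //.
    have fl : is_flag f (i x, i y, true) by rewrite /is_flag /= fE xS yS.
    by case: (no_cycles36_charge f_simple f_min f_cubic curv n1 n2 fl).
  apply: dec_cubic_neighbours => // x xS d4.
  have dx : degree f (i x) = 4 by apply/eqP; rewrite f_deg // eqn_leq d4 deg4.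
  have [y] : exists y, y \in nbr_in e S x.
    by apply/card_gt0P; apply: leq_trans (min3 _ xS).
  rewrite inE => /andP[yS exy].
  have fxy : f (i x) (i y) by rewrite fE xS yS.
  apply: leq_trans (no_cycles36_cubic_nbrs f_simple f_min f_cubic curv n1 n2 fxy dx) _.
  rewrite -(card_imset _ i_inj); apply/subset_leq_card/subsetP => b.
  rewrite inE => /andP[/fP[x' [z [_ zS exz /i_inj eq_x <-]]]].
  rewrite f_deg // => /eqP dz; apply: imset_f.
  by rewrite !inE zS -eq_x exz dz.
- by case: (no_cycles46_contradiction f_simple f_min f_cubic curv flag0 n1 n2).
Qed.

Lemma dec_all (S : {set T}) : decomposable_in e S set0.
Proof.
elim: {S}_.+1 {-2}S (ltnSn #|S|) => // n IHn S; rewrite ltnS => leSn.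
have decP (S' : {set T}) : S' \proper S -> decomposable_in e S' set0.
  by move=> S'S; apply: IHn; apply: leq_trans (proper_card S'S) leSn.
have [->|S0] := eqVneq S set0; first exact: dec0.
have [/existsP[v /andP[vS dv]]|] := boolP [exists v, (v \in S) && (#|nbr_in e S v| <= 2)].
  apply: (@dec_sub _ _ _ (v |: set0)); first by rewrite set0I sub0set.
  by apply: dec_low_degree => //; apply: decP; rewrite properD1.
rewrite negb_exists => /forallP high.
have [/existsP[u /existsP[v /and5P[uS vS euv du dv]]]|] := boolP [exists u, exists v,
    [&& u \in S, v \in S, e u v, #|nbr_in e S u| <= 3 & #|nbr_in e S v| <= 3]].
  apply: (dec_adjacent3 e_simple uS vS euv du dv); apply: decP.
  by apply: sub_proper_trans (subsetDl _ _) _; rewrite properD1.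
rewrite negb_exists => /forallP no_pair; apply: irreducible_dec => // [v vS|u v uS vS euv du].
  by have := high v; rewrite vS -ltnNge.
have := no_pair u; rewrite negb_exists => /forallP/(_ v).
by rewrite uS vS euv du -ltnNge.
Qed.

End Main.

Theorem theorem1p4 (T : finType) (e : rel T)
  (e_simple : simple_graph e)
  (e_surface : embeds_nonneg_char e)
  (e_cycles : [\/ ~ has_cycle 3 e /\ ~ has_cycle 4 e,
                  ~ has_cycle 3 e /\ ~ has_cycle 6 e
                | ~ has_cycle 4 e /\ ~ has_cycle 6 e]) :
  decomposable 2 1 e.
Proof. exact/dec_decomposable/dec_all. Qed.
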